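(* Let $\bar X\in\mathbb{R}_{\ge0}^{m\times n}$ and suppose $(p,q)$ are the row and column sums of a draw from the biproportional Poisson model with base matrix $\bar X$ and true parameters $(u^*,v^* )$. Let $\mathcal L^*=-\nabla^2\ell(u^*,v^* )=\begin{bmatrix}\mathrm{diag}(W\mathbf 1_n)&-W\\-W^T&\mathrm{diag}(W^T\mathbf 1_m)\end{bmatrix}$, where $W_{ij}=e^{u^*_i}\bar X_{ij}e^{-v^*_j}$. If $\lambda_{-2}(\mathcal L^* )\ge 8\log(m+n)$, then with probability at least $1-2/\sqrt{m+n}$ the function $\ell$ has a finite maximizer that is unique up to the shift $(u,v)\mapsto(u+c\mathbf 1_m,v+c\mathbf 1_n)$, $c\in\mathbb{R}$ (i.e. a unique normalized finite maximizer), and IPF on $(\bar X,p,q)$ converges to this solution.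
   Context: Biproportional Poisson model: given $\bar X\in\mathbb{R}_{\ge0}^{m\times n}$ and $u\in\mathbb{R}^m$, $v\in\mathbb{R}^n$, entries $Y_{ij}$ are independent with $Y_{ij}\sim\mathrm{Poisson}(e^{u_i}\bar X_{ij}e^{-v_j})$ if $\bar X_{ij}>0$ and $Y_{ij}=0$ otherwise; $p_i=\sum_jY_{ij}$, $q_j=\sum_iY_{ij}$. Log-likelihood: $\ell(u,v)=\sum_ip_iu_i-\sum_jq_jv_j-\sum_{ij}\bar X_{ij}e^{u_i-v_j}$. $\lambda_{-2}(\cdot)$ denotes the second-smallest eigenvalue. IPF on $(X,p,q)$: start with $d^0=\mathbf 1_m$, $d^1=\mathbf 1_n$ and alternately set $d^0_i\leftarrow p_i/\sum_jX_{ij}d^1_j$ for all $i$, then $d^1_j\leftarrow q_j/\sum_iX_{ij}d^0_i$ for all $j$; the corresponding parameters are $(\log d^0,-\log d^1)$. *)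

(* Defs.v *)
From HB Require Import structures.
From mathcomp Require Import all_boot all_order all_algebra.
From mathcomp Require Import all_classical all_reals all_analysis.

Set Implicit Arguments.
Unset Strict Implicit.
Unset Printing Implicit Defensive.

Import Order.TTheory GRing.Theory Num.Theory.
Import numFieldNormedType.Exports.
Local Open Scope ring_scope.
Local Open Scope classical_set_scope.

Section BiproportionalPoisson.
Variables (R : realType) (m n : nat).
Implicit Types (Xb : 'M[R]_(m, n)) (u : 'I_m -> R) (v : 'I_n -> R).

(* Poisson(lam) probability mass function (with 0^0 = 1, so Poisson(0) = Dirac 0). *)
Definition poisson_pmf (lam : R) (k : nat) : R :=
  expR (- lam) * lam ^+ k / (k`!)%:R.

Definition bp_weight Xb u v : 'M[R]_(m, n) :=
  \matrix_(i, j) (expR (u i) * Xb i j * expR (- v j)).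

(* Joint pmf of the matrix Y of independent entries Y_ij ~ Poisson(W_ij)
   (Y_ij = 0 a.s. when Xbar_ij = 0). *)
Definition bp_pmf Xb u v (Y : 'M[nat]_(m, n)) : R :=
  \prod_(i < m) \prod_(j < n) poisson_pmf (bp_weight Xb u v i j) (Y i j).

Definition bp_prob Xb u v (E : set 'M[nat]_(m, n)) : \bar R :=
  \esum_(Y in E) (bp_pmf Xb u v Y)%:E.

Definition row_sums (Y : 'M[nat]_(m, n)) : 'I_m -> R :=
  fun i => (\sum_(j < n) Y i j)%:R.
Definition col_sums (Y : 'M[nat]_(m, n)) : 'I_n -> R :=
  fun j => (\sum_(i < m) Y i j)%:R.

Definition loglik Xb (p : 'I_m -> R) (q : 'I_n -> R) u v : R :=
  \sum_(i < m) p i * u i - \sum_(j < n) q j * v j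
  - \sum_(i < m) \sum_(j < n) Xb i j * expR (u i - v j).

Definition is_maximizer Xb p q u v : Prop :=
  forall u' v', loglik Xb p q u' v' <= loglik Xb p q u v.

Definition unique_maximizer_up_to_shift Xb p q u v : Prop :=
  is_maximizer Xb p q u v /\
  forall u' v', is_maximizer Xb p q u' v' ->
    exists c : R, (forall i, u' i = u i + c) /\ (forall j, v' j = v j + c).

Definition ipf_step Xb (p : 'I_m -> R) (q : 'I_n -> R)
    (d : ('I_m -> R) * ('I_n -> R)) : ('I_m -> R) * ('I_n -> R) :=
  let d0 := fun i => p i / \sum_(j < n) Xb i j * d.2 j in
  (d0, fun j => q j / \sum_(i < m) Xb i j * d0 i).

Definition ipf Xb p q (k : nat) : ('I_m -> R) * ('I_n -> R) :=
  iter k (ipf_step Xb p q) (fun _ => 1, fun _ => 1).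

(* The IPF parameters (log d^0, -log d^1) converge to (u,v), written
   equivalently as d^0 -> e^u and d^1 -> e^{-v} entrywise. *)
Definition ipf_converges_to Xb p q u v : Prop :=
  (forall i, (fun k : nat => (ipf Xb p q k).1 i : R) @ \oo --> (expR (u i) : R)) /\
  (forall j, (fun k : nat => (ipf Xb p q k).2 j : R) @ \oo --> (expR (- v j) : R)).

Definition good_outcome Xb (Y : 'M[nat]_(m, n)) : Prop :=
  exists u v,
    unique_maximizer_up_to_shift Xb (row_sums Y) (col_sums Y) u v /\
    ipf_converges_to Xb (row_sums Y) (col_sums Y) u v.

(* L = [[diag(W 1), -W], [-W^T, diag(W^T 1)]]  (= - Hessian of l). *)
Definition bp_laplacian (W : 'M[R]_(m, n)) : 'M[R]_(m + n) :=
  block_mx (diag_mx (\row_i \sum_(j < n) W i j)) (- W)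
           (- W^T) (diag_mx (\row_j \sum_(i < m) W i j)).

End BiproportionalPoisson.

Definition sorted_spectrum (R : realType) (N : nat) (A : 'M[R]_N) (s : seq R) : Prop :=
  sorted <=%R s /\ char_poly A = \prod_(x <- s) ('X - x%:P).

(* Main.v *)
Require Import Defs.
From HB Require Import structures.
From mathcomp Require Import all_boot all_order all_algebra.
From mathcomp Require Import all_classical all_reals all_analysis.
From mathcomp Require Import complex ring lra.
Import Order.TTheory GRing.Theory Num.Theory.
Import numFieldNormedType.Exports.
Local Open Scope ring_scope.
Set Implicit Arguments.
Unset Strict Implicit.
Unset Printing Implicit Defensive.

(**
Call a vertex set A (rows and columns together) a closed cut if A is nonempty
and proper and no entry of the base matrix joins a row outside A to a column
in A. If in every closed cut some Y_ij with i in A, j outside A is nonzero,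
then the digraph with arrows j -> i for Xbar_ij > 0 and i -> j for Y_ij > 0 is
strongly connected. On a superlevel set of the log-likelihood the parameters
can increase only boundedly along an arrow, so superlevel sets are bounded up
to shift: a maximizer exists, and strict concavity along edges makes it unique
up to shift.

Relative to a maximizer, IPF alternates weighted harmonic means of the ratios
r, s. Their range can only shrink, and sum p_i ln r_i + sum q_j ln s_j increases
by a relative entropy at each step, so r_i s_j -> 1 along every edge;
connectivity gives a common limit.

For a random draw, the closed cut A fails with probability exp(-w(A)), where w(A)
is the weight of the cut. The spectral gap gives w(A) >= lambda |A| |A^c| / N
with N = m + n, so the union bound over all A is at most
2 ((1 + N^-4)^N - 1) <= 4 N^-3 <= 2 / sqrt N.
*)

(** * Spectral gap and cuts *)

Lemma char_poly_similar (F : comUnitRingType) (N : nat) (P D : 'M[F]_N) :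
  P \in unitmx -> char_poly (invmx P *m D *m P) = char_poly D.
Proof.
move=> uP; rewrite /char_poly.
have -> : char_poly_mx (invmx P *m D *m P) =
    map_mx polyC (invmx P) *m char_poly_mx D *m map_mx polyC P.
  rewrite /char_poly_mx !map_mxM mulmxBr mulmxBl; congr (_ - _).
  by rewrite -mulmxA -scalar_mxC mulmxA -map_mxM mulVmx// map_mx1 mul1mx.
by rewrite !det_mulmx mulrAC -det_mulmx -map_mxM mulVmx// map_mx1 det1 mul1r.
Qed.

(** Strictness makes this survive a repeated second value. In a list with fewer than two entries the
    second entry defaults to 0, and the bound holds by length alone. *)
Lemma sorted_count_lt_snd (R : realDomainType) (s : seq R) :
  sorted <=%R s -> (count (fun x => (x < s`_1)%R) s <= 1)%N.
Proof.
case: s => [|a [|b s]] //=; first by rewrite addn0; case: (_ < _).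
move=> /andP[_ bs]; rewrite ltxx add0n.
suff -> : count (fun x => x < b) s = 0%N by rewrite addn0; case: (_ < _).
apply/eqP; rewrite -leqn0 leqNgt -has_count -all_predC.
have /= := order_path_min le_trans bs.
by apply: sub_all => x /= bx; rewrite -leNgt.
Qed.

Local Open Scope sesquilinear_scope.

(* Only one eigenvalue lies below the second one, and a nonzero kernel vector [e]
   spans its eigenspace; orthogonality to [e] kills that coordinate of [x]. *)
Lemma symmetric_gap (R : rcfType) (N : nat) (A : 'M[R]_N) (s : seq R)
    (e x : 'rV[R]_N) :
  A^T = A -> sorted <=%R s -> char_poly A = \prod_(y <- s) ('X - y%:P) ->
  0 < s`_1 -> e *m A = 0 -> e != 0 -> x *m e^T = 0 ->
  s`_1 * (x *m x^T) 0 0 <= (x *m A *m x^T) 0 0.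
Proof.
move=> sA ss chA s1 eA e0 xe.
(* The spectral theorem is applied over the complex extension; [f] embeds the real data there. *)
pose C : numClosedFieldType := R[i]%C.
pose f : {rmorphism R -> C} := real_complex R.
have conjf y : Num.conj (f y) = f y by exact: conjc_real.
have conjfT m1 m2 (B : 'M[R]_(m1, m2)) : (map_mx f B)^t* = map_mx f B^T.
  by apply/matrixP => i j; rewrite !mxE; exact: conjf.
pose B := map_mx f A; pose P := spectralmx B; pose d := spectral_diag B.
have nB : B \is normalmx.
  by apply/normalmxP; rewrite conjfT sA.
have uP : P \is unitarymx by exact: spectral_unitarymx.
have PU : P \in unitmx by exact: spectral_unit.
have BE : B = P^t* *m diag_mx d *m P.
  by rewrite -(invmx_unitary uP); exact/orthomx_spectralP.
have PP : P^t* *m P = 1%:M by rewrite -(invmx_unitary uP) mulVmx.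
have PK : (P^t*)^t* = P.
  by rewrite map_trmx -map_mx_comp trmxK; apply: map_mx_id => t; exact: conjCK.
(* Both lists are the roots of one characteristic polynomial, so the diagonal [d] is [s] up to
   order, with multiplicities; in particular it is real. *)
have pe : perm_eq (map f s) (codom (d 0)).
  apply: prod_XsubC_eq.
  rewrite big_map big_image /=.
  transitivity (char_poly B); last first.
    rewrite BE -(invmx_unitary uP) char_poly_similar// char_poly_trig ?diag_mx_is_trig//.
    by apply: eq_bigr => i _; rewrite mxE eqxx mulr1n.
  rewrite -map_char_poly chA rmorph_prod/=.
  by apply: eq_bigr => y _; rewrite rmorphB/= map_polyX map_polyC.
pose lam := f s`_1.
have dr i : exists2 y, y \in s & d 0 i = f y.
  have : d 0 i \in map f s by rewrite (perm_mem pe) codom_f.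
  by case/mapP => y ys ->; exists y.
have card1 : (#|[set i | (d 0 i < lam)%R]| <= 1)%N.
  have -> : #|[set i | d 0 i < lam]| = count (fun z => z < lam) (codom (d 0)).
    rewrite cardsE /codom /image_mem count_map cardE /enum_mem size_filter.
    rewrite count_filter; apply: eq_count => i /=; rewrite !inE andbT //.
  rewrite -(permP pe) count_map.
  under eq_count do rewrite /= /lam ltcR.
  exact: sorted_count_lt_snd.
have tcE (w : 'rV[C]_N) i : (w^t*) i 0 = Num.conj (w 0 i) by rewrite !mxE.
(* Coordinates of [e] and [x] in the eigenbasis. Since [e] is in the kernel, [y] lives only where
   [d] vanishes, which turns out to be the single index [i0]. *)
pose y := map_mx f e *m P^t*; pose z := map_mx f x *m P^t*.
have yd i : y 0 i * d 0 i = 0.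
  have : y *m diag_mx d = 0.
    rewrite /y -mulmxA.
    have -> : P^t* *m diag_mx d = B *m P^t*.
      by rewrite BE -!mulmxA (unitarymxP uP) mulmx1.
    by rewrite mulmxA -map_mxM eA map_mx0 mul0mx.
  by move/matrixP/(_ 0 i); rewrite mul_mx_diag !mxE.
have yne0 : exists i, y 0 i != 0.
  apply/existsP; apply: contraNT e0; rewrite negb_exists => /forallP y0.
  have : y = 0 by apply/rowP => i; rewrite [RHS]mxE; apply/eqP; rewrite -[_ == _]negbK.
  move/(congr1 (mulmx^~ P)); rewrite /y -mulmxA PP mulmx1 mul0mx.
  move/rowP => fe; apply/eqP/rowP => i; have := fe i; rewrite !mxE.
  by move/eqP; rewrite fmorph_eq0 => /eqP.
have lam0 : 0 < lam by rewrite /lam -[0]/(f 0) ltcR.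
have [i0 yi0] := yne0.
have di0 : d 0 i0 = 0.
  by apply/eqP; have /eqP := yd i0; rewrite mulf_eq0 (negbTE yi0).
have dge i : i != i0 -> lam <= d 0 i.
  move=> ii0; have [t _ dt] := dr i.
  rewrite dt lecR leNgt -ltcR -dt; apply/negP => lti.
  have : ([set i; i0] \subset [set i | d 0 i < lam]).
    by rewrite finset.subUset !finset.sub1set !inE di0 lti lam0.
  by move/subset_leq_card; rewrite cards2 ii0 => /leq_trans/(_ card1).
have zi0 : z 0 i0 = 0.
  have : z *m y^t* = 0.
    rewrite /z /y trmx_mul map_mxM -!mulmxA PK.
    by rewrite [P^t* *m _]mulmxA PP mul1mx conjfT -map_mxM xe map_mx0.
  move/matrixP/(_ 0 0); rewrite mxE (bigD1 i0)//= [RHS]mxE big1 ?addr0.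
    move/eqP; rewrite tcE mulf_eq0 => /orP[/eqP//|].
    by rewrite fmorph_eq0 (negbTE yi0).
  move=> i ii0; rewrite tcE.
  suff -> : y 0 i = 0 by rewrite rmorph0 mulr0.
  have /eqP := yd i; rewrite mulf_eq0 => /orP[/eqP//|/eqP di].
  by have := dge _ ii0; rewrite di lt_geF.
have qf : (map_mx f x *m B *m (map_mx f x)^t*) 0 0 = \sum_i d 0 i * `|z 0 i| ^+ 2.
  have -> : map_mx f x *m B *m (map_mx f x)^t* = z *m diag_mx d *m z^t*.
    by rewrite BE /z trmx_mul map_mxM PK -!mulmxA.
  rewrite mxE; apply: eq_bigr => i _.
  by rewrite mul_mx_diag tcE mxE normCK mulrAC mulrC.
have nf : (map_mx f x *m (map_mx f x)^t*) 0 0 = \sum_i `|z 0 i| ^+ 2.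
  have -> : map_mx f x *m (map_mx f x)^t* = z *m z^t*.
    by rewrite /z trmx_mul map_mxM PK -!mulmxA [P^t* *m _]mulmxA PP mul1mx.
  by rewrite mxE; apply: eq_bigr => i _; rewrite tcE normCK.
rewrite -lecR -[(_ * _)%:C%C]/(f _) -[X in _ <= X]/(f _) rmorphM /=.
have fE (M : 'M[R]_1) : f (M 0 0) = (map_mx f M) 0 0 by rewrite mxE.
rewrite !fE !map_mxM -conjfT -/B qf nf mulr_sumr.
apply: ler_sum => i _; have [->|ii0] := eqVneq i i0.
  by rewrite zi0 normr0 expr0n !mulr0.
by rewrite ler_wpM2r ?exprn_ge0 ?normr_ge0// dge.
Qed.

Local Close Scope sesquilinear_scope.
Local Open Scope classical_set_scope.

Lemma mul_row_mx_tr (R : comPzRingType) (k : nat) (x y : 'rV[R]_k) :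
  (x *m y^T) 0 0 = \sum_i x 0 i * y 0 i.
Proof. by rewrite mxE; apply: eq_bigr => i _; rewrite mxE. Qed.

Lemma tr_bp_laplacian (R : realType) (m n : nat) (W : 'M[R]_(m, n)) :
  (bp_laplacian W)^T = bp_laplacian W.
Proof.
by rewrite /bp_laplacian tr_block_mx !tr_diag_mx !linearN /= trmxK.
Qed.

Lemma bp_laplacian_ones (R : realType) (m n : nat) (W : 'M[R]_(m, n)) :
  const_mx 1 *m bp_laplacian W = 0 :> 'rV_(m + n).
Proof.
rewrite -row_mx_const /bp_laplacian mul_row_block -[RHS]row_mx0.
by congr row_mx; apply/rowP => k; rewrite mul_mx_diag mulmxN !mxE mul1r;
  [rewrite -sumrB | rewrite addrC -sumrB]; rewrite big1 // => j _;
  rewrite !mxE mul1r subrr.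
Qed.

(** This is the Dirichlet form of the bipartite graph with edge weights [W]; on an indicator vector
    it measures a cut. *)
Lemma bp_laplacian_form (R : realType) (m n : nat) (W : 'M[R]_(m, n))
    (u : 'rV[R]_m) (v : 'rV[R]_n) :
  (row_mx u v *m bp_laplacian W *m (row_mx u v)^T) 0 0 =
  \sum_i \sum_j W i j * (u 0 i - v 0 j) ^+ 2.
Proof.
rewrite /bp_laplacian mul_row_block tr_row_mx mul_row_col mxE.
rewrite mul_row_mx_tr [X in _ + X]mul_row_mx_tr.
have -> : \sum_i (u *m diag_mx (\row_i0 \sum_j W i0 j) + v *m - W^T) 0 i * u 0 i =
    \sum_i \sum_j (W i j * u 0 i ^+ 2 - W i j * u 0 i * v 0 j).
  apply: eq_bigr => i _; rewrite mul_mx_diag mulmxN !mxE.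
  rewrite mulrDl mulNr sumrB -!mulr_suml mulrAC -expr2 mulrC; congr (_ - _).
  rewrite mulr_suml; apply: eq_bigr => j _; rewrite !mxE; ring.
have -> : \sum_i (u *m - W + v *m diag_mx (\row_j \sum_i0 W i0 j)) 0 i * v 0 i =
    \sum_i \sum_j (W i j * v 0 j ^+ 2 - W i j * u 0 i * v 0 j).
  rewrite exchange_big /=; apply: eq_bigr => j _; rewrite mul_mx_diag mulmxN !mxE.
  rewrite mulrDl mulNr sumrB addrC -!mulr_suml mulrAC -expr2 mulrC; congr (_ - _).
  by congr (_ * _); apply: eq_bigr => i _; rewrite mulrC.
rewrite -big_split /=; apply: eq_bigr => i _.
by rewrite -big_split /=; apply: eq_bigr => j _; ring.
Qed.

Lemma sum_indicator (R : pzRingType) (T : finType) (A : {set T}) :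
  \sum_z (z \in A)%:R = #|A|%:R :> R.
Proof.
rewrite -sum1_card natr_sum [RHS]big_mkcond.
by apply: eq_bigr => z _; case: (z \in A).
Qed.

(** The test vector is the indicator of [A] minus its mean [c]: it is orthogonal to the constant
    kernel vector, and centring leaves the Dirichlet form unchanged. *)
Lemma cut_ge_gap (R : realType) (m n : nat) (W : 'M[R]_(m, n)) (s : seq R)
    (A : {set 'I_m + 'I_n}) :
  sorted_spectrum (bp_laplacian W) s -> 0 < s`_1 ->
  s`_1 * (#|A|%:R * #|~: A|%:R / (m + n)%:R) <=
  \sum_i \sum_j W i j * ((inl i \in A) != (inr j \in A))%:R.
Proof.
move=> [ss chs] s1.
have sizes : size s = (m + n)%N.
  by have := size_char_poly (bp_laplacian W); rewrite chs size_prod_XsubC => -[].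
(* A positive second entry of [s] cannot be the default 0 of a short list. *)
have N1 : (1 < m + n)%N.
  by rewrite -sizes ltnNge; apply: contraTN s1 => /(nth_default 0) ->; rewrite ltxx.
have N0 : (m + n)%:R != 0 :> R by rewrite pnatr_eq0 -lt0n (ltn_trans _ N1).
pose g z : R := (z \in A)%:R; pose c : R := #|A|%:R / (m + n)%:R.
pose u := \row_i (g (inl i) - c) : 'rV[R]_m.
pose v := \row_j (g (inr j) - c) : 'rV[R]_n.
have sumE (h : 'I_m + 'I_n -> R) : \sum_i h (inl i) + \sum_j h (inr j) = \sum_z h z.
  by rewrite big_sumType.
have cardV : (\sum_(z : 'I_m + 'I_n) 1 = (m + n)%:R :> R).
  by rewrite sumr_const card_sum !card_ord.
have sumg : \sum_z g z = #|A|%:R by exact: sum_indicator.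
have xe : row_mx u v *m (const_mx 1 : 'rV[R]_(m + n))^T = 0.
  apply/matrixP => i j; rewrite !ord1 mul_row_mx_tr [RHS]mxE big_split_ord /=.
  under eq_bigr do rewrite row_mxEl !mxE mulr1.
  under [X in _ + X]eq_bigr do rewrite row_mxEr !mxE mulr1.
  rewrite (sumE (fun z => g z - c)) sumrB sumg.
  rewrite -[X in \sum_(_ | _) X]mulr1 -mulr_sumr cardV /c; field.
  by rewrite -natrD.
have e0 : const_mx 1 != 0 :> 'rV[R]_(m + n).
  apply/eqP => /matrixP /(_ 0 (Ordinal (ltnW N1))); rewrite !mxE.
  by move/eqP; rewrite oner_eq0.
have := symmetric_gap (tr_bp_laplacian W) ss chs s1 (bp_laplacian_ones W) e0 xe.
rewrite bp_laplacian_form mul_row_mx_tr.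
have -> : \sum_i row_mx u v 0 i * row_mx u v 0 i = #|A|%:R * #|~: A|%:R / (m + n)%:R.
  rewrite big_split_ord /=.
  under eq_bigr do rewrite row_mxEl !mxE.
  under [X in _ + X]eq_bigr do rewrite row_mxEr !mxE.
  rewrite (sumE (fun z => (g z - c) * (g z - c))).
  under eq_bigr => z _.
    have -> : (g z - c) * (g z - c) = (1 - 2 * c) * g z + c ^+ 2 * 1.
      by rewrite /g; case: (z \in A); rewrite /=; ring.
    over.
  rewrite big_split /= -!mulr_sumr sumg cardV (cardsCs (~: A)%SET) finset.setCK.
  rewrite card_sum !card_ord natrB ?natrD.
    by rewrite /c natrD; field; rewrite -natrD.
  by have := max_card A; rewrite card_sum !card_ord.
move=> /le_trans; apply; apply: ler_sum => i _; apply: ler_sum => j _.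
rewrite !mxE /g; case: (inl i \in A); case: (inr j \in A) => /=; rewrite le_eqVlt;
 apply/orP; left; apply/eqP; ring.
Qed.

(** * Probability of an empty cut *)

Section CutEvents.
Variables (R : realType) (m n : nat).
Implicit Types (Xb : 'M[R]_(m, n)) (A : {set 'I_m + 'I_n}) (Y : 'M[nat]_(m, n)).

(** Closed under the column-to-row arrows given by the support of [Xb], so that only an arrow coming
    from a nonzero count can leave [A]. *)
Definition closed_cut Xb A : bool :=
  [&& #|A| != 0%N, #|~: A| != 0%N &
    [forall i, forall j, (inl i \notin A) && (inr j \in A) ==> (Xb i j == 0)]].

Definition out_cut A (e : 'I_m * 'I_n) : bool :=
  (inl e.1 \in A) && (inr e.2 \notin A).

Definition empty_out_cut Y A : bool :=
  [forall e, out_cut A e ==> (Y e.1 e.2 == 0%N)].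

(** The first clause fails only on draws of mass zero; the second is strong connectivity of the
    digraph, phrased through cuts for the union bound. *)
Definition irreducible_draw Xb Y : Prop :=
  (forall i j, Xb i j = 0 -> Y i j = 0%N) /\
  (forall A, closed_cut Xb A -> ~~ empty_out_cut Y A).

End CutEvents.

(* The analysis library has its own [poisson_pmf], hence the qualified name. *)
Lemma sum_poisson_pmf (R : realType) (lam : R) (K : nat) :
  \sum_(k < K) Defs.poisson_pmf lam k = expR (- lam) * series (exp_coeff lam) K.
Proof.
rewrite /series /= mulr_sumr big_mkord; apply: eq_bigr => k _.
by rewrite /Defs.poisson_pmf /exp_coeff /= -mulrA.
Qed.

Lemma bp_poisson_pmf_ge0 (R : realType) (lam : R) (k : nat) :
  0 <= lam -> 0 <= Defs.poisson_pmf lam k.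
Proof.
by move=> l0; rewrite /Defs.poisson_pmf !mulr_ge0 ?expR_ge0 ?exprn_ge0 ?invr_ge0.
Qed.

Lemma sum_poisson_pmf_le1 (R : realType) (lam : R) (K : nat) :
  0 <= lam -> \sum_(k < K) Defs.poisson_pmf lam k <= 1.
Proof.
move=> l0; rewrite sum_poisson_pmf expRN mulrC ler_pdivrMr ?expR_gt0// mul1r.
apply: nondecreasing_cvgn_le; last exact: is_cvg_series_exp_coeff.
by apply: nondecreasing_series => k _ _; exact: exp_coeff_ge0.
Qed.

Lemma cvg_sum_poisson_pmf (R : realType) (lam : R) :
  (fun K : nat => \sum_(k < K) Defs.poisson_pmf lam k) @ \oo --> (1 : R).
Proof.
under eq_fun do rewrite sum_poisson_pmf.
rewrite -(expRxMexpNx_1 lam) mulrC.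
by apply: cvgM; [exact: cvg_cst | exact: is_cvg_series_exp_coeff].
Qed.

(** * Union bound over closed cuts, on truncated draws *)

Section UnionBound.
Variables (R : realType) (m n : nat) (Xb : 'M[R]_(m, n)).
Variables (us : 'I_m -> R) (vs : 'I_n -> R).
Hypothesis Xb_ge0 : forall i j, 0 <= Xb i j.
Let W := bp_weight Xb us vs.

Lemma bp_weight_ge0 i j : 0 <= W i j.
Proof. by rewrite mxE !mulr_ge0 ?expR_ge0. Qed.

Lemma bp_pmf_ge0 Y : 0 <= bp_pmf Xb us vs Y.
Proof.
by do 2! (apply: prodr_ge0 => ? _); apply: bp_poisson_pmf_ge0; exact: bp_weight_ge0.
Qed.

Lemma bp_pmf_support (Y : 'M[nat]_(m, n)) i j :
  Xb i j = 0 -> Y i j != 0%N -> bp_pmf Xb us vs Y = 0.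
Proof.
move=> X0 Y0; apply/eqP; rewrite prodf_seq_eq0; apply/hasP; exists i => //=.
  by rewrite mem_index_enum.
rewrite prodf_seq_eq0; apply/hasP; exists j; first by rewrite mem_index_enum.
by rewrite /= /Defs.poisson_pmf mxE X0 mulr0 mul0r expr0n (negbTE Y0) mulr0 mul0r.
Qed.

(* Draws with all entries below [K] form a finite type; the probability bounds are
   finite sums over it, and [K] tends to infinity only at the end. *)
Definition box_draw (K : nat) (g : {ffun 'I_m * 'I_n -> 'I_K}) : 'M[nat]_(m, n) :=
  \matrix_(i, j) (g (i, j) : nat).

Lemma box_draw_inj K : injective (@box_draw K).
Proof.
move=> g h /matrixP gh; apply/ffunP => -[i j]; apply: val_inj.
by have := gh i j; rewrite !mxE.
Qed.

Lemma bp_pmf_box K (g : {ffun 'I_m * 'I_n -> 'I_K}) :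
  bp_pmf Xb us vs (box_draw g) = \prod_e Defs.poisson_pmf (W e.1 e.2) (g e).
Proof.
rewrite /bp_pmf pair_bigA /=; apply: eq_bigr => -[i j] _ /=.
by rewrite [X in Defs.poisson_pmf _ X]mxE.
Qed.

(** By independence the sum factorizes over entries. An entry leaving [A] contributes its
    probability of being zero, [expR (- W)]; any other entry contributes at most 1. *)
Lemma sum_box_out_cut K (A : {set 'I_m + 'I_n}) :
  \sum_(g : {ffun 'I_m * 'I_n -> 'I_K} | empty_out_cut (box_draw g) A)
     bp_pmf Xb us vs (box_draw g)
  <= expR (- \sum_(e | out_cut A e) W e.1 e.2).
Proof.
pose F e (k : 'I_K) : R :=
  Defs.poisson_pmf (W e.1 e.2) k * (out_cut A e ==> (k == 0%N :> nat))%:R.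
have F0 e k : 0 <= F e k.
  by rewrite mulr_ge0 ?ler0n// bp_poisson_pmf_ge0 ?bp_weight_ge0.
have -> : \sum_(g : {ffun 'I_m * 'I_n -> 'I_K} | empty_out_cut (box_draw g) A)
     bp_pmf Xb us vs (box_draw g) =
     \sum_(g : {ffun 'I_m * 'I_n -> 'I_K}) \prod_e F e (g e).
  rewrite big_mkcond /=; apply: eq_bigr => g _; rewrite bp_pmf_box.
  have -> : \prod_e F e (g e) = (\prod_e Defs.poisson_pmf (W e.1 e.2) (g e)) *
      \prod_e (out_cut A e ==> (g e == 0%N :> nat))%:R by rewrite -big_split.
  case: ifPn => [/forallP h|].
    rewrite [X in _ * X]big1 ?mulr1// => -[i j] _.
    by have := h (i, j); rewrite mxE => ->.
  rewrite negb_forall => /existsP[[i j]]; rewrite mxE /= => /negbTE h.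
  by rewrite [X in _ * X](bigD1 (i, j))//= h mul0r mulr0.
rewrite -bigA_distr_bigA /= -sumrN expR_sum [X in _ <= X]big_mkcond /=.
apply: ler_prod => e _; rewrite sumr_ge0//=; case: ifPn => oe; last first.
  under eq_bigr do rewrite /F (negbTE oe) mulr1.
  by rewrite sum_poisson_pmf_le1 ?bp_weight_ge0.
rewrite /F oe /=; case: K {F F0} => [|K]; first by rewrite big_ord0 expR_ge0.
rewrite big_ord_recl big1 ?addr0; last by move=> k _; rewrite mulr0.
by rewrite mulr1 /Defs.poisson_pmf expr0 mulr1 divr1.
Qed.

Lemma cvg_box_mass :
  (fun K => \prod_(e : 'I_m * 'I_n) \sum_(k < K) Defs.poisson_pmf (W e.1 e.2) k) @ \oo
  --> (1 : R).
Proof.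
rewrite -[X in _ --> X](_ : \prod_(e : 'I_m * 'I_n) (1 : R) = _); last by rewrite big1.
by apply: cvg_big => [|e _]; [exact: mul_continuous | exact: cvg_sum_poisson_pmf].
Qed.

(** A draw that is not irreducible either charges an entry off the support, and has mass zero, or
    leaves some closed cut empty, and is then counted in the sum over cuts. *)
Lemma sum_box_irreducible K :
  \prod_(e : 'I_m * 'I_n) \sum_(k < K) Defs.poisson_pmf (W e.1 e.2) k
  - \sum_(A | closed_cut Xb A) expR (- \sum_(e | out_cut A e) W e.1 e.2)
  <= \sum_(g : {ffun 'I_m * 'I_n -> 'I_K} | `[< irreducible_draw Xb (box_draw g) >])
       bp_pmf Xb us vs (box_draw g).
Proof.
rewrite lerBlDr bigA_distr_bigA /=.
under eq_bigr do rewrite -bp_pmf_box.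
apply: (@le_trans _ _ (\sum_(g : {ffun 'I_m * 'I_n -> 'I_K} |
    `[< irreducible_draw Xb (box_draw g) >]) bp_pmf Xb us vs (box_draw g) +
    \sum_(A | closed_cut Xb A)
      \sum_(g : {ffun 'I_m * 'I_n -> 'I_K} | empty_out_cut (box_draw g) A)
     bp_pmf Xb us vs (box_draw g))); last first.
  by rewrite lerD2l; apply: ler_sum => A _; exact: sum_box_out_cut.
under [X in _ <= _ + X]eq_bigr do rewrite big_mkcond.
rewrite exchange_big [X in _ <= X + _]big_mkcond -big_split /=.
apply: ler_sum => g _; have p0 := bp_pmf_ge0 (box_draw g).
have s0 (B : {set 'I_m + 'I_n} -> bool) : 0 <= \sum_(A | B A)
    (if empty_out_cut (box_draw g) A then bp_pmf Xb us vs (box_draw g) else 0).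
  by apply: sumr_ge0 => A _; case: ifP.
case: asboolP => [_|nirr]; first by rewrite lerDl; exact: s0.
rewrite add0r; have [|supp] := pselect (exists i j, Xb i j = 0 /\ box_draw g i j != 0%N).
  by move=> [i [j [X0 Y0]]]; rewrite (bp_pmf_support X0 Y0) big1// => A _; case: ifP.
have [A cA eA] : exists2 A, closed_cut Xb A & empty_out_cut (box_draw g) A.
  apply: contrapT => nA; apply: nirr; split.
    move=> i j X0; apply/eqP; rewrite -[_ == _]negbK; apply/negP => Y0.
    by apply: supp; exists i, j.
  by move=> A cA; apply/negP => eA; apply: nA; exists A.
rewrite (bigD1 A)//= eA lerDl.
exact: (s0 (fun B => closed_cut Xb B && (B != A))).
Qed.

Lemma bp_prob_ge_union_bound (E : set 'M[nat]_(m, n)) (b : R) :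
  (forall Y, irreducible_draw Xb Y -> E Y) ->
  \sum_(A | closed_cut Xb A) expR (- \sum_(e | out_cut A e) W e.1 e.2) <= b ->
  ((1 - b)%:E <= bp_prob Xb us vs E)%E.
Proof.
move=> irrE hb.
have box K : ((\prod_(e : 'I_m * 'I_n) \sum_(k < K) Defs.poisson_pmf (W e.1 e.2) k - b)%:E
    <= bp_prob Xb us vs E)%E.
  apply: (@le_trans _ _ (\sum_(g : {ffun 'I_m * 'I_n -> 'I_K} |
      `[< irreducible_draw Xb (box_draw g) >]) bp_pmf Xb us vs (box_draw g))%:E).
    by rewrite lee_fin; apply: le_trans (sum_box_irreducible K); rewrite lerB.
  pose r := [seq box_draw g | g <- enum [pred g : {ffun 'I_m * 'I_n -> 'I_K} |
      `[< irreducible_draw Xb (box_draw g) >]]].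
  apply: esum_ge; exists [set` r].
    split; first exact: finite_seq.
    move=> Y /= /mapP[g]; rewrite mem_enum => /asboolP ig ->; exact: irrE.
  rewrite fsumEFin ?lee_fin; last exact: finite_seq.
  rewrite -fsbig_seq; last by rewrite map_inj_uniq ?enum_uniq//; exact: box_draw_inj.
  by rewrite /r big_map big_enum.
(* For a finite value, let [K] tend to infinity in [box]; the value minus infinity already
   contradicts [box] at 0. *)
case: (bp_prob Xb us vs E) box => [r box| |box].
- rewrite lee_fin lerBlDr.
  apply: (cvgr_to_le cvg_box_mass); apply: nearW => K.
  by have := box K; rewrite lee_fin lerBlDr.
- by rewrite leey.
- by have := box 0%N.
Qed.

End UnionBound.

(** * Numerical estimate of the union bound *)

Lemma sum_expr_card (R : comPzRingType) (T : finType) (x : R) :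
  \sum_(A : {set T}) x ^+ #|A| = (x + 1) ^+ #|T|.
Proof.
rewrite -prodr_const bigA_distr /=.
by apply: eq_bigr => A _; rewrite -big_mkcond /= prodr_const.
Qed.

(** With [y] the product of [N] and [x], the power is at most [expR y], which is at most 1/(1 - y);
    for [y] up to 1/2 this exceeds 1 by at most 2y. *)
Lemma expr1D_le (R : realType) (x : R) (N : nat) :
  0 <= x -> N%:R * x <= 2^-1 -> (x + 1) ^+ N - 1 <= 2 * (N%:R * x).
Proof.
move=> x0 Nx; set y := N%:R * x in Nx *.
have y0 : 0 <= y by rewrite mulr_ge0.
have : (x + 1) ^+ N <= expR y.
  by rewrite expRM_natl lerXn2r ?nnegrE ?expR_ge0 ?addr_ge0// addrC expR_ge1Dx.
have : expR y * (1 - y) <= 1.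
  by rewrite -[X in _ <= X](expRxMexpNx_1 y) ler_wpM2l ?expR_ge0// expR_ge1Dx.
have := expR_gt0 y; nra.
Qed.

(** The larger side is at least half of the total, so the exponent is at least [lam] / 2, hence 4 ln
    N, times the smaller side. Keeping both powers on the right avoids naming the smaller side. *)
Lemma expR_cut_le (R : realType) (lam : R) (k k' : nat) :
  (0 < k + k')%N -> 8 * ln (k + k')%:R <= lam ->
  expR (- (lam * (k%:R * k'%:R / (k + k')%:R))) <=
  ((k + k')%:R ^- 4) ^+ k + ((k + k')%:R ^- 4) ^+ k'.
Proof.
move=> N0 hlam.
wlog kk : k k' N0 hlam / (k <= k')%N.
  move=> wl; have [kk|/ltnW kk] := leqP k k'; first exact: wl.
  have := wl k' k; rewrite addnC (mulrC k'%:R) => /(_ N0 hlam kk).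
  by rewrite [X in _ <= X]addrC.
set N : R := (k + k')%:R in hlam *.
have Npos : 0 < N by rewrite ltr0n.
have lnN : 0 <= ln N by rewrite ln_ge0// ler1n.
rewrite (@le_trans _ _ ((N ^- 4) ^+ k))// ?lerDl ?exprn_ge0 ?invr_ge0 ?exprn_ge0 ?(ltW Npos)//.
have -> : (N ^- 4) ^+ k = expR (- (4 * ln N * k%:R)).
  rewrite expRN mulrAC mulrC -natrM mulr_natr -lnXn// lnK; last by rewrite posrE exprn_gt0.
  by rewrite exprVn -exprM.
rewrite ler_expR lerN2.
have h : k%:R * 2^-1 <= k%:R * k'%:R / N.
  rewrite -mulrA ler_wpM2l ?ler0n// ler_pdivlMr//.
  by rewrite /N natrD mulrC ler_pdivrMr// mulr_natr mulr2n lerD2r ler_nat.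
apply: (@le_trans _ _ (8 * ln N * (k%:R * 2^-1))).
  by rewrite le_eqVlt; apply/orP; left; apply/eqP; field.
by apply: ler_pM => //; rewrite ?mulr_ge0 ?ler0n.
Qed.

Lemma cut_union_bound (R : realType) (m n : nat) (Xb : 'M[R]_(m, n))
    (us : 'I_m -> R) (vs : 'I_n -> R) (s : seq R) :
  (0 < m)%N -> (0 < n)%N -> (forall i j, 0 <= Xb i j) ->
  sorted_spectrum (bp_laplacian (bp_weight Xb us vs)) s ->
  8 * ln (m + n)%:R <= s`_1 ->
  \sum_(A | closed_cut Xb A)
     expR (- \sum_(e | out_cut A e) bp_weight Xb us vs e.1 e.2)
  <= 2 / Num.sqrt (m + n)%:R.
Proof.
move=> m0 n0 X0 spec gap; set W := bp_weight Xb us vs.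
set N := (m + n)%N in gap *.
have N2 : (2 <= N)%N by rewrite /N -(addn1 1) leq_add.
have Npos : 0 < N%:R :> R by rewrite ltr0n (leq_trans _ N2).
have s1 : 0 < s`_1.
  by apply: lt_le_trans gap; rewrite mulr_gt0// ln_gt0// ltr1n.
pose x : R := N%:R ^- 4.
have x0 : 0 <= x by rewrite invr_ge0 exprn_ge0 ?ltW.
have cardN (A : {set 'I_m + 'I_n}) : (#|A| + #|~: A| = N)%N.
  by rewrite cardsC card_sum !card_ord.
apply: (@le_trans _ _ (\sum_(A : {set 'I_m + 'I_n} | closed_cut Xb A)
    (x ^+ #|A| + x ^+ #|~: A|))).
  apply: ler_sum => A /and3P[A0 A1 /forallP cA].
  have := @expR_cut_le R s`_1 #|A| #|~: A|; rewrite cardN => /(_ (ltnW N2) gap).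
  apply: le_trans; rewrite ler_expR lerN2.
  apply: (le_trans (cut_ge_gap A spec s1)).
  (* Entries crossing a closed cut inwards have weight zero, so the undirected cut weight is carried
     by the outgoing entries. *)
  rewrite pair_bigA [X in _ <= X]big_mkcond /=; apply: ler_sum => -[i j] _ /=.
  rewrite /out_cut /=; have /forallP/(_ j) := cA i.
  case: (inl i \in A); case: (inr j \in A); rewrite /= ?mulr0 ?mulr1 //.
  by move=> /eqP Xij; rewrite mxE Xij mulr0 mul0r.
apply: (@le_trans _ _ (2 * ((x + 1) ^+ N - 1))).
  (* Discarding the empty set removes the term 1 of the binomial sum; complementation gives the same
     bound for the other half. *)
  have half : \sum_(A : {set 'I_m + 'I_n} | #|A| != 0%N) x ^+ #|A| = (x + 1) ^+ N - 1.
    have <- : #|{: 'I_m + 'I_n}| = N by rewrite card_sum !card_ord.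
    rewrite -sum_expr_card [in RHS](bigD1 finset.set0)//= cards0 expr0 addrAC subrr add0r.
    by apply: eq_bigl => A; rewrite cards_eq0.
  have sub (B : pred {set 'I_m + 'I_n}) (F : {set 'I_m + 'I_n} -> R) :
      (forall A, closed_cut Xb A -> B A) -> (forall A, 0 <= F A) ->
      \sum_(A | closed_cut Xb A) F A <= \sum_(A | B A) F A.
    move=> cB F0; rewrite big_mkcond [X in _ <= X]big_mkcond; apply: ler_sum => A _.
    by case: ifPn => [/cB ->//|_]; case: ifP.
  rewrite big_split /= mulr_natl mulr2n; apply: lerD.
    by rewrite -half; apply: sub => [A /and3P[]//|A]; exact: exprn_ge0.
  rewrite -half [X in _ <= X](reindex_inj (@finset.setC_inj _)) /=.
  by apply: sub => [A /and3P[]//|A]; exact: exprn_ge0.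
(* In powers of [q] the remaining claim is that 2 is at most the fifth power of [q], which follows
   from [q2]. *)
pose q : R := Num.sqrt N%:R.
have q0 : 0 < q by rewrite sqrtr_gt0.
have qN : q ^+ 2 = N%:R by rewrite sqr_sqrtr ?ltW.
have q2 : 2 <= q ^+ 2 by rewrite qN ler_nat.
have Nx : N%:R * x = q ^- 6.
  rewrite /x -qN; field; exact: lt0r_neq0.
have q6 : 2 <= q ^+ 6.
  rewrite (exprM q 2 3) exprS; have : 4 <= (q ^+ 2) ^+ 2 by nra.
  nra.
have : (x + 1) ^+ N - 1 <= 2 * (N%:R * x).
  by apply: expr1D_le => //; rewrite Nx lef_pV2 ?posrE ?exprn_gt0.
rewrite -/q Nx => h.
have -> : 2 / q = 2 * (q ^+ 5 * q ^- 6) by field; exact: lt0r_neq0.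
rewrite ler_pM2l//; apply: (le_trans h).
rewrite ler_pM2r ?invr_gt0 ?exprn_gt0//.
have q1 : 1 <= q by nra.
rewrite (exprS q 4) (exprM q 2 2).
have : 4 <= (q ^+ 2) ^+ 2 by nra.
nra.
Qed.

(** * Convergence of the scaling iteration *)

Section RealSequences.
Variable R : realType.
Implicit Types f g : nat -> R.

Lemma cvg0_le f g (C : R) :
  (forall k, `|f k| <= C * g k) -> g @ \oo --> (0 : R) -> f @ \oo --> (0 : R).
Proof.
move=> fg g0; apply: norm_cvg0.
apply: (@squeeze_cvgr _ _ _ _ (fun=> 0) (fun k => C * g k)).
- by apply: nearW => k; rewrite normr_ge0 fg.
- exact: cvg_cst.
- by rewrite -(mulr0 C); apply: cvgM => //; exact: cvg_cst.
Qed.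

Lemma cvg0_sqr f : (fun k => f k ^+ 2) @ \oo --> (0 : R) -> f @ \oo --> (0 : R).
Proof.
move=> /cvgr0Pnorm_lt f2; apply/cvgr0Pnorm_lt => e e0.
apply: filterS (f2 _ (exprn_gt0 2 e0)) => k /=.
by rewrite normrX ltr_pXn2r ?nnegrE ?normr_ge0 ?(ltW e0).
Qed.

Lemma cvg1_div f g : f @ \oo --> (1 : R) -> g @ \oo --> (1 : R) ->
  (fun k => f k / g k) @ \oo --> (1 : R).
Proof.
move=> hf hg; have := cvgM hf (cvgV (@oner_neq0 R) hg).
rewrite invr1 mulr1 => h; exact: h.
Qed.

End RealSequences.

(** Apply ln t <= t - 1 at the square root of [a] and double. The square makes the relative entropy
    control the distance of [a] from 1. *)
Lemma sqr_sqrtB1_le (R : realType) (a : R) :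
  0 < a -> (Num.sqrt a - 1) ^+ 2 <= a - 1 - ln a.
Proof.
move=> a0; have s0 : 0 < Num.sqrt a by rewrite sqrtr_gt0.
have sa : Num.sqrt a ^+ 2 = a by rewrite sqr_sqrtr ?ltW.
have : ln (Num.sqrt a) <= Num.sqrt a - 1.
  have := @le_ln1Dx R (Num.sqrt a - 1); rewrite (addrC 1) subrK; apply.
  by rewrite ltrBrDl subrr.
have -> : ln a = 2 * ln (Num.sqrt a).
  by rewrite -[in LHS]sa lnXn// mulr_natl.
by move=> h; nra.
Qed.

Lemma relative_entropy_ge0 (R : realType) (x : R) : 0 < x -> 0 <= x - 1 - ln x.
Proof. by move=> /sqr_sqrtB1_le; apply: le_trans; exact: sqr_ge0. Qed.

(** Above 1 use ln y >= 1 - 1/y, which costs a factor [y] bounded by [D]; below 1 use ln y <= y - 1,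
    which costs nothing. *)
Lemma sqrB1_le_lnM (R : realType) (y D : R) :
  0 < y -> 1 <= D -> y <= D -> (y - 1) ^+ 2 <= D * ((y - 1) * ln y).
Proof.
move=> y0 D1 yD.
have l1 : ln y <= y - 1.
  have := @le_ln1Dx R (y - 1); rewrite (addrC 1) subrK; apply.
  by rewrite ltrBrDl subrr.
have l2 : - ln y <= y^-1 - 1.
  have := @le_ln1Dx R (y^-1 - 1); rewrite (addrC 1) subrK lnV ?posrE//; apply.
  by rewrite ltrBrDl subrr invr_gt0.
have [y1|/ltW y1] := leP 1 y.
  apply: (@le_trans _ _ (D * ((y - 1) * (1 - y^-1)))).
    have -> : (y - 1) ^+ 2 = y * ((y - 1) * (1 - y^-1)).
      by field; exact: lt0r_neq0.
    by apply: ler_wpM2r => //; rewrite mulr_ge0 ?subr_ge0// invf_le1.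
  apply: ler_wpM2l; first lra.
  by apply: ler_wpM2l; lra.
apply: (@le_trans _ _ ((y - 1) * ln y)); first by nra.
by rewrite ler_peMl//; nra.
Qed.

(** The quotient is the reciprocal of a weighted mean of [x]. Each half step of the scaling has this
    form once the margins are written as sums of [Z]. *)
Lemma harmonic_mean_bounds (R : realFieldType) (T : finType) (w x : T -> R) (A B : R) :
  (forall t, 0 <= w t) -> 0 < \sum_t w t -> 0 < A -> 0 < B ->
  (forall t, A <= x t <= B) ->
  B^-1 <= (\sum_t w t) / (\sum_t w t * x t) <= A^-1.
Proof.
move=> w0 S0 A0 B0 xAB; set S := \sum_t w t in S0 *; set Q := \sum_t _ * _.
have QA : A * S <= Q.
  rewrite mulr_sumr; apply: ler_sum => t _; rewrite mulrC ler_wpM2l//.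
  by have /andP[] := xAB t.
have QB : Q <= B * S.
  rewrite mulr_sumr; apply: ler_sum => t _; rewrite mulrC ler_wpM2r//.
  by have /andP[] := xAB t.
have Q0 : 0 < Q by apply: lt_le_trans QA; rewrite mulr_gt0.
by rewrite ler_pdivlMr// ler_pdivrMl// QB ler_pdivrMr// ler_pdivlMl// QA.
Qed.

(* The scaling iteration, written for the ratios [r], [s] of its iterates to an
   exact scaling [Z] of the data; [Z] then has the prescribed margins. *)
Section Sinkhorn.
Variables (R : realType) (m n : nat) (Z : 'I_m -> 'I_n -> R).
Variables (p : 'I_m -> R) (q : 'I_n -> R).
Hypothesis n_gt0 : (0 < n)%N.
Hypothesis Z_ge0 : forall i j, 0 <= Z i j.
Hypothesis rowZ : forall i, \sum_j Z i j = p i.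
Hypothesis colZ : forall j, \sum_i Z i j = q j.
Hypothesis p_gt0 : forall i, 0 < p i.
Hypothesis q_gt0 : forall j, 0 < q j.
(** Connectivity of the support of [Z], as a principle for propagating a property along edges from
    one column. *)
Hypothesis Z_connected : forall (P : 'I_m -> Prop) (Q : 'I_n -> Prop) (j0 : 'I_n),
  Q j0 -> (forall i j, 0 < Z i j -> (P i <-> Q j)) ->
  (forall i, P i) /\ (forall j, Q j).

Variables (r : nat -> 'I_m -> R) (s : nat -> 'I_n -> R) (A B : R).
Hypotheses (A_gt0 : 0 < A) (B_gt0 : 0 < B).
Hypothesis s0_bounds : forall j, A <= s 0 j <= B.
Hypothesis sE : forall k j, s k j = q j / \sum_i Z i j * r k i.
Hypothesis rE : forall k i, r k.+1 i = p i / \sum_j Z i j * s k j.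
Hypothesis r0_bounds : forall i, B^-1 <= r 0 i <= A^-1.

Lemma sinkhorn_step (k : nat) (a b : R) : 0 < a -> 0 < b ->
  (forall j, a <= s k j <= b) ->
  (forall i, b^-1 <= r k.+1 i <= a^-1) /\ (forall j, a <= s k.+1 j <= b).
Proof.
move=> a0 b0 hs.
have hr i : b^-1 <= r k.+1 i <= a^-1.
  rewrite rE -rowZ; apply: harmonic_mean_bounds => //.
  by rewrite rowZ.
split => // j.
have := @harmonic_mean_bounds R _ (fun i => Z i j) (r k.+1) b^-1 a^-1.
rewrite !invrK sE -colZ; apply; rewrite ?invr_gt0 ?colZ//.
Qed.

Lemma sinkhorn_bounds k :
  (forall i, B^-1 <= r k i <= A^-1) /\ (forall j, A <= s k j <= B).
Proof.
elim: k => [//|k [_ hs]]; exact: sinkhorn_step.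
Qed.

Lemma sinkhorn_r_gt0 k i : 0 < r k i.
Proof.
have [/(_ i)/andP[h _] _] := sinkhorn_bounds k.
by apply: lt_le_trans h; rewrite invr_gt0.
Qed.

Lemma sinkhorn_s_gt0 k j : 0 < s k j.
Proof.
have [_ /(_ j)/andP[h _]] := sinkhorn_bounds k.
exact: lt_le_trans h.
Qed.

Lemma sinkhorn_sum_col k j : s k j * \sum_i Z i j * r k i = q j.
Proof.
(* A zero denominator would make the quotient 0, against positivity of [s]. *)
have : s k j != 0 by rewrite lt0r_neq0 ?sinkhorn_s_gt0.
rewrite sE => h; rewrite mulfVK//; apply: contraNneq h => ->.
by rewrite invr0 mulr0.
Qed.

Lemma sinkhorn_sum_row k i : r k.+1 i * \sum_j Z i j * s k j = p i.
Proof.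
have : r k.+1 i != 0 by rewrite lt0r_neq0 ?sinkhorn_r_gt0.
rewrite rE => h; rewrite mulfVK//; apply: contraNneq h => ->.
by rewrite invr0 mulr0.
Qed.

Lemma sinkhorn_sum_margins : \sum_i p i = \sum_j q j.
Proof.
under eq_bigr do rewrite -rowZ.
by rewrite exchange_big; apply: eq_bigr => j _.
Qed.

Let a k i := r k i / r k.+1 i.
Let b k j := s k j / s k.+1 j.

(** So [a] measures the row error of the scaled matrix at a moment when its column sums are
    exact. *)
Lemma sinkhorn_p_a k i : p i * a k i = \sum_j Z i j * r k i * s k j.
Proof.
rewrite -(sinkhorn_sum_row k) /a mulrC mulrA divfK ?lt0r_neq0 ?sinkhorn_r_gt0// mulr_sumr.
by apply: eq_bigr => j _; rewrite mulrCA mulrA.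
Qed.

Lemma sinkhorn_q_b k j : q j * b k j = \sum_i Z i j * r k.+1 i * s k j.
Proof.
rewrite -(sinkhorn_sum_col k.+1) /b mulrC mulrA divfK ?lt0r_neq0 ?sinkhorn_s_gt0// mulr_sumr.
by apply: eq_bigr => i _; rewrite mulrC.
Qed.

Lemma sinkhorn_sum_p_a k : \sum_i p i * a k i = \sum_i p i.
Proof.
under eq_bigr do rewrite sinkhorn_p_a.
rewrite exchange_big sinkhorn_sum_margins; apply: eq_bigr => j _.
by rewrite -mulr_suml mulrC sinkhorn_sum_col.
Qed.

Lemma sinkhorn_sum_q_b k : \sum_j q j * b k j = \sum_j q j.
Proof.
under eq_bigr do rewrite sinkhorn_q_b.
rewrite exchange_big -sinkhorn_sum_margins; apply: eq_bigr => i _ /=.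
rewrite -(sinkhorn_sum_row k i) mulr_sumr.
by apply: eq_bigr => j _; rewrite mulrCA mulrA.
Qed.

(** Up to a constant this is the log-likelihood along the iteration, because the total mass of the
    scaled matrix stays fixed. *)
Let G k := \sum_i p i * ln (r k i) + \sum_j q j * ln (s k j).

(** The logarithms give the increment; the terms linear in [a] and [b] sum to zero because total
    mass is preserved, and adding them makes every summand nonnegative. *)
Lemma sinkhorn_lyapunov_step k :
  G k.+1 - G k = \sum_i p i * (a k i - 1 - ln (a k i)) +
                 \sum_j q j * (b k j - 1 - ln (b k j)).
Proof.
have -> : \sum_i p i * (a k i - 1 - ln (a k i)) =
    \sum_i p i * ln (r k.+1 i) - \sum_i p i * ln (r k i).
  transitivity (\sum_i p i * a k i - \sum_i p i +
      (\sum_i p i * ln (r k.+1 i) - \sum_i p i * ln (r k i))).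
    rewrite -!sumrB -big_split /=; apply: eq_bigr => i _.
    by rewrite /a ln_div ?posrE ?sinkhorn_r_gt0//; ring.
  by rewrite sinkhorn_sum_p_a subrr add0r.
have -> : \sum_j q j * (b k j - 1 - ln (b k j)) =
    \sum_j q j * ln (s k.+1 j) - \sum_j q j * ln (s k j).
  transitivity (\sum_j q j * b k j - \sum_j q j +
      (\sum_j q j * ln (s k.+1 j) - \sum_j q j * ln (s k j))).
    rewrite -!sumrB -big_split /=; apply: eq_bigr => j _.
    by rewrite /b ln_div ?posrE ?sinkhorn_s_gt0//; ring.
  by rewrite sinkhorn_sum_q_b subrr add0r.
by rewrite /G; ring.
Qed.

Lemma sinkhorn_a_gt0 k i : 0 < a k i. Proof. by rewrite divr_gt0 ?sinkhorn_r_gt0. Qed.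
Lemma sinkhorn_b_gt0 k j : 0 < b k j. Proof. by rewrite divr_gt0 ?sinkhorn_s_gt0. Qed.

Lemma sinkhorn_lyapunov_step_ge k i :
  p i * (Num.sqrt (a k i) - 1) ^+ 2 <= G k.+1 - G k.
Proof.
rewrite sinkhorn_lyapunov_step (bigD1 i)//= -addrA.
apply: ler_wpDr; last by rewrite ler_wpM2l ?(ltW (p_gt0 i))// sqr_sqrtB1_le ?sinkhorn_a_gt0.
by rewrite addr_ge0// sumr_ge0// => t _; rewrite mulr_ge0 ?(ltW (p_gt0 _)) ?(ltW (q_gt0 _))
  ?relative_entropy_ge0 ?sinkhorn_a_gt0 ?sinkhorn_b_gt0.
Qed.

Lemma sinkhorn_lyapunov_cvg : cvg (G @ \oo).
Proof.
apply: nondecreasing_is_cvgn.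
  apply/nondecreasing_seqP => k; rewrite -subr_ge0 sinkhorn_lyapunov_step.
  by rewrite addr_ge0// sumr_ge0// => t _; rewrite mulr_ge0 ?(ltW (p_gt0 _)) ?(ltW (q_gt0 _))
    ?relative_entropy_ge0 ?sinkhorn_a_gt0 ?sinkhorn_b_gt0.
exists (\sum_i p i * ln A^-1 + \sum_j q j * ln B) => _ [k _ <-].
have [hr hs] := sinkhorn_bounds k.
apply: lerD; apply: ler_sum => t _; rewrite ler_wpM2l ?(ltW (p_gt0 _)) ?(ltW (q_gt0 _))//;
  rewrite ler_ln ?posrE ?invr_gt0 ?sinkhorn_r_gt0 ?sinkhorn_s_gt0//.
  by have /andP[] := hr t.
by have /andP[] := hs t.
Qed.

(** Increments of the convergent sequence [G] vanish, and each dominates a multiple of the squared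
    distance of the root of [a] from 1. *)
Lemma sinkhorn_a_cvg1 i : (fun k => a k i) @ \oo --> (1 : R).
Proof.
have dG : (fun k => G k.+1 - G k) @ \oo --> (0 : R).
  rewrite -(subrr (limn G)); apply: cvgB; last exact: sinkhorn_lyapunov_cvg.
  by have := sinkhorn_lyapunov_cvg; rewrite -(cvg_shiftS G).
have : (fun k => Num.sqrt (a k i) - 1) @ \oo --> (0 : R).
  apply: cvg0_sqr; apply: (cvg0_le (C := (p i)^-1)) dG => k.
  rewrite ger0_norm ?sqr_ge0// mulrC ler_pdivlMr// mulrC; exact: sinkhorn_lyapunov_step_ge.
move=> /(cvgD (cvg_cst (1 : R))); rewrite addr0 => h.
have -> : (fun k => a k i) =
    (fun k => (1 + (Num.sqrt (a k i) - 1)) * (1 + (Num.sqrt (a k i) - 1))).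
  apply/funext => k; rewrite (addrC 1) subrK -expr2 sqr_sqrtr//.
  exact: ltW (sinkhorn_a_gt0 k i).
have := cvgM h h; rewrite mulr1 => h2; exact: h2.
Qed.

(** Split ln (r s) into ln r + ln s. Exact column sums cancel the ln s part, and the row errors
    remain. *)
Lemma sinkhorn_sum_entropy k :
  \sum_i \sum_j Z i j * ((r k i * s k j - 1) * ln (r k i * s k j)) =
  \sum_i p i * (a k i - 1) * ln (r k i).
Proof.
transitivity (\sum_i (\sum_j Z i j * r k i * s k j) * ln (r k i)
    + \sum_j (s k j * \sum_i Z i j * r k i) * ln (s k j)
    - (\sum_i (\sum_j Z i j) * ln (r k i) + \sum_j (\sum_i Z i j) * ln (s k j))).
  have ex (f : 'I_m -> 'I_n -> R) (g : 'I_n -> R) :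
     \sum_j (\sum_i f i j) * g j = \sum_i \sum_j f i j * g j.
    by rewrite exchange_big; apply: eq_bigr => j _; rewrite mulr_suml.
  have -> : \sum_j (s k j * \sum_i Z i j * r k i) * ln (s k j) =
      \sum_i \sum_j s k j * (Z i j * r k i) * ln (s k j).
    by rewrite -ex; apply: eq_bigr => j _; rewrite mulr_sumr.
  rewrite !ex; under [X in X + _ - _]eq_bigr do rewrite mulr_suml.
  under [X in _ - (X + _)]eq_bigr do rewrite mulr_suml.
  rewrite -!big_split -sumrB /=; apply: eq_bigr => i _.
  rewrite -!big_split -sumrB /=; apply: eq_bigr => j _.
  by rewrite lnM ?posrE ?sinkhorn_r_gt0 ?sinkhorn_s_gt0//; ring.
under [X in X + _ - _]eq_bigr do rewrite -sinkhorn_p_a.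
under [X in _ + X - _]eq_bigr do rewrite sinkhorn_sum_col.
under [X in _ - (X + _)]eq_bigr do rewrite rowZ.
under [X in _ - (_ + X)]eq_bigr do rewrite colZ.
rewrite opprD addrACA subrr addr0 -sumrB; apply: eq_bigr => i _; ring.
Qed.

Lemma sinkhorn_ln_r_bounded : exists C, forall k i, `|ln (r k i)| <= C.
Proof.
exists (`|ln A| + `|ln B|) => k i.
have [/(_ i)/andP[h1 h2] _] := sinkhorn_bounds k.
have : ln (r k i) <= - ln A by rewrite -lnV// ler_ln// ?posrE ?sinkhorn_r_gt0 ?invr_gt0.
have : - ln B <= ln (r k i) by rewrite -lnV// ler_ln// ?posrE ?sinkhorn_r_gt0 ?invr_gt0.
have := ler_norm (ln A); have := ler_norm (- ln A).
have := ler_norm (ln B); have := ler_norm (- ln B); rewrite !normrN.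
by rewrite ler_norml => *; apply/andP; split; lra.
Qed.

Lemma sinkhorn_rs_cvg1 i j : 0 < Z i j -> (fun k => r k i * s k j) @ \oo --> (1 : R).
Proof.
move=> Zij; have [C lnC] := sinkhorn_ln_r_bounded.
have E0 : (fun k => \sum_i p i * (a k i - 1) * ln (r k i)) @ \oo --> (0 : R).
  rewrite -[X in _ --> X](_ : \sum_(i < m) (0 : R) = 0); last by rewrite big1.
  apply: cvg_big => [|l _]; first exact: add_continuous.
  have : (fun k => `|a k l - 1|) @ \oo --> (0 : R).
    rewrite -(@normr0 _ R); apply: cvg_norm; rewrite -(subrr 1).
    by apply: cvgB; [exact: sinkhorn_a_cvg1 | exact: cvg_cst].
  apply: (cvg0_le (C := p l * C)) => k.
  rewrite !normrM (gtr0_norm (p_gt0 l)) -!mulrA ler_pM2l// mulrC.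
  by rewrite ler_wpM2r.
have y0 k t l : 0 < r k t * s k l by rewrite mulr_gt0 ?sinkhorn_r_gt0 ?sinkhorn_s_gt0.
(* The products of [r] and [s] are at most B/A; adding 1 secures the condition 1 <= D of
   [sqrB1_le_lnM]. *)
have D1 : 1 <= 1 + A^-1 * B by rewrite lerDl mulr_ge0 ?invr_ge0 ?ltW.
have yD k t l : r k t * s k l <= 1 + A^-1 * B.
  have [/(_ t)/andP[_ h1] /(_ l)/andP[_ h2]] := sinkhorn_bounds k.
  apply: (@le_trans _ _ (A^-1 * B)); last by rewrite lerDr.
  by rewrite ler_pM ?(ltW (sinkhorn_r_gt0 _ _)) ?(ltW (sinkhorn_s_gt0 _ _)).
have t0 k t l : 0 <= Z t l * ((r k t * s k l - 1) * ln (r k t * s k l)).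
  rewrite mulr_ge0//.
  have := sqrB1_le_lnM (y0 k t l) D1 (yD k t l).
  move=> /(le_trans (sqr_ge0 _)); rewrite pmulr_rge0//; lra.
suff : (fun k => r k i * s k j - 1) @ \oo --> (0 : R).
  move=> /(cvgD (cvg_cst (1 : R))); rewrite addr0 => h.
  have -> : (fun k => r k i * s k j) = (fun k => 1 + (r k i * s k j - 1)).
    by apply/funext => k; rewrite (addrC 1) subrK.
  exact: h.
apply: cvg0_sqr; apply: (cvg0_le (C := (1 + A^-1 * B) / Z i j)) E0 => k.
rewrite ger0_norm ?sqr_ge0// -sinkhorn_sum_entropy.
apply: (le_trans (sqrB1_le_lnM (y0 k i j) D1 (yD k i j))).
rewrite -[X in _ <= X]mulrA; apply: ler_wpM2l; first lra.
rewrite ler_pdivlMl//; apply: (@le_trans _ _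
  (\sum_l Z i l * ((r k i * s k l - 1) * ln (r k i * s k l)))).
  rewrite (bigD1 j)//= lerDl; exact: sumr_ge0.
rewrite (bigD1 i)//= lerDl; apply: sumr_ge0 => t _; exact: sumr_ge0.
Qed.

(** Both properties compare with the anchor column [j0]; on an edge each implies the other, since
    there the product of [r] and [s] tends to 1. *)
Lemma sinkhorn_ratio_cvg1 j0 :
  (forall i, (fun k => r k i * s k j0) @ \oo --> (1 : R)) /\
  (forall j, (fun k => s k j / s k j0) @ \oo --> (1 : R)).
Proof.
apply: (Z_connected (j0 := j0)).
  under eq_fun do rewrite divff ?lt0r_neq0 ?sinkhorn_s_gt0//; exact: cvg_cst.
move=> i j /sinkhorn_rs_cvg1 h; split => h'.
  have -> : (fun k => s k j / s k j0) = (fun k => (r k i * s k j) * (r k i * s k j0)^-1).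
    by apply/funext => k; field; rewrite !lt0r_neq0 ?sinkhorn_r_gt0 ?sinkhorn_s_gt0.
  exact: cvg1_div.
have -> : (fun k => r k i * s k j0) = (fun k => (r k i * s k j) * (s k j / s k j0)^-1).
  by apply/funext => k; field; rewrite !lt0r_neq0 ?sinkhorn_r_gt0 ?sinkhorn_s_gt0.
exact: cvg1_div.
Qed.

Lemma sinkhorn_cvg : exists2 c : R, 0 < c &
  (forall i, (fun k => r k i) @ \oo --> c^-1) /\
  (forall j, (fun k => s k j) @ \oo --> c).
Proof.
(* The default [A] is a lower bound of all [s], so this is the true maximum. It is nonincreasing by
   [sinkhorn_step] with [M k] as upper bound, and its limit is the common limit [c]. *)
pose M k := \big[Num.max/A]_j s k j.
have sM k j : s k j <= M k by exact: le_bigmax.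
have AM k : A <= M k.
  have [_ /(_ (Ordinal n_gt0))/andP[h _]] := sinkhorn_bounds k.
  exact: le_trans h (sM _ _).
have Mcvg : cvg (M @ \oo).
  apply: nonincreasing_is_cvgn.
    apply/nonincreasing_seqP => k; apply: bigmax_le => // j _.
    have [] := @sinkhorn_step k A (M k) A_gt0 (lt_le_trans A_gt0 (AM k)).
      move=> l; rewrite sM andbT.
      by have [_ /(_ l)/andP[]] := sinkhorn_bounds k.
    by move=> _ /(_ j)/andP[].
  by exists A => _ [k _ <-].
pose c := limn M.
have c0 : 0 < c.
  apply: (lt_le_trans A_gt0); apply: limr_ge => //; exact: nearW.
have sc j : (fun k => s k j) @ \oo --> c.
  have d0 l : (fun k => s k l - s k j) @ \oo --> (0 : R).
    have [_ /(_ l) h] := sinkhorn_ratio_cvg1 j.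
    have : (fun k => `|s k l / s k j - 1|) @ \oo --> (0 : R).
      rewrite -(@normr0 _ R); apply: cvg_norm; rewrite -(subrr 1).
      by apply: cvgB => //; exact: cvg_cst.
    apply: (cvg0_le (C := B)) => k.
    have sp := sinkhorn_s_gt0 k j.
    have -> : s k l - s k j = s k j * (s k l / s k j - 1).
      by field; exact: lt0r_neq0.
    rewrite normrM ler_wpM2r// gtr0_norm//.
    by have [_ /(_ j)/andP[]] := sinkhorn_bounds k.
  have S0 : (fun k => \sum_l `|s k l - s k j|) @ \oo --> (0 : R).
    rewrite -[X in _ --> X](_ : \sum_(l < n) (0 : R) = 0); last by rewrite big1.
    apply: cvg_big => [|l _]; first exact: add_continuous.
    by rewrite -(@normr0 _ R); apply: cvg_norm.
  have : (fun k => M k - s k j) @ \oo --> (0 : R).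
    apply: (cvg0_le (C := 1)) S0 => k.
    rewrite mul1r ger0_norm ?subr_ge0// lerBlDr; apply: bigmax_le.
      rewrite ler_wpDl ?sumr_ge0//.
      by have [_ /(_ j)/andP[]] := sinkhorn_bounds k.
    move=> l _; rewrite -lerBlDr (bigD1 l)//=.
    by apply: ler_wpDr; [exact: sumr_ge0 | exact: ler_norm].
  move=> h; have := cvgB Mcvg h; rewrite subr0 => h2.
  have <- : M - (fun k => M k - s k j) = (fun k => s k j).
    by apply/funext => k; rewrite !fctE; ring.
  exact: h2.
exists c => //; split => // i.
pose j0 := Ordinal n_gt0.
have [/(_ i) h _] := sinkhorn_ratio_cvg1 j0.
have -> : (fun k => r k i) = (fun k => (r k i * s k j0) * (s k j0)^-1).
  by apply/funext => k; rewrite mulfK// lt0r_neq0 ?sinkhorn_s_gt0.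
have := cvgM h (cvgV (lt0r_neq0 c0) (sc j0)); rewrite mul1r => h2; exact: h2.
Qed.

End Sinkhorn.

(** * Existence and uniqueness of the maximizer *)

(** For positive [y] the maximum is at a = ln (y/x); the tangent bound expR (t - a) >= 1 + t - a
    gives the value y (a - 1). *)
Lemma mul_expR_bound (R : realType) (x y : R) : 0 < x -> 0 <= y ->
  exists2 C, 0 <= C & forall t, y * t - x * expR t <= C.
Proof.
move=> x0 y0; exists (y * `|ln (y / x)|); first by rewrite mulr_ge0.
move=> t; have [->|yn0] := eqVneq y 0.
  by rewrite !mul0r add0r oppr_le0 mulr_ge0 ?expR_ge0 ?ltW.
have yp : 0 < y by rewrite lt0r yn0.
set a := ln (y / x).
have ea : x * expR t = y * expR (t - a).
  rewrite expRD expRN lnK ?posrE ?divr_gt0//; field.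
  by rewrite !lt0r_neq0.
rewrite ea -mulrBr ler_wpM2l//.
have := expR_ge1Dx (t - a); have := ler_norm a; lra.
Qed.

Lemma level_bounded (R : realType) (x y K : R) : 0 <= x -> 0 <= y ->
  (x = 0 -> y = 0) ->
  exists T, forall t, - K <= y * t - x * expR t ->
    (x != 0 -> t <= T) /\ (y != 0 -> - t <= T).
Proof.
move=> x0 y0 xy; have [x_eq0|xn0] := eqVneq x 0.
  by exists 0 => t _; rewrite (xy x_eq0) eqxx.
have xp : 0 < x by rewrite lt0r xn0.
(* Half of the exponential absorbs the linear term; the other half is left to bound [t] from
   above. *)
have [C C0 hC] := @mul_expR_bound R (x / 2) y (divr_gt0 xp (ltr0Sn _ 1)) y0.
exists (`|2 * (C + K) / x| + `|K / y|) => t ht; split => [_|yn0].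
  rewrite (@le_trans _ _ (2 * (C + K) / x))//.
    rewrite ler_pdivlMr//.
    have := hC t; have := expR_ge1Dx t; nra.
  by rewrite (le_trans (ler_norm _))// lerDl.
have yp : 0 < y by rewrite lt0r yn0.
rewrite (@le_trans _ _ (K / y))//.
  rewrite ler_pdivlMr//.
  have : 0 <= x * expR t by rewrite mulr_ge0 ?expR_ge0.
  lra.
by rewrite (le_trans (ler_norm _))// lerDr.
Qed.

(** A first-order condition without derivatives: t = 1 excludes r = 0, and t = - ln (r/p) makes the
    relative entropy of r/p nonpositive, forcing r/p = 1. *)
Lemma stationary_scalar (R : realType) (p r : R) : 0 < p -> 0 <= r ->
  (forall t, p * t <= r * (expR t - 1)) -> r = p.
Proof.
move=> p0 r0 h.
have rp : 0 < r.
  rewrite lt0r r0 andbT; apply/eqP => re; have := h 1; rewrite re; lra.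
have a0 : 0 < r / p by rewrite divr_gt0.
have := h (- ln (r / p)); rewrite expRN lnK ?posrE// mulrBr mulr1 invf_div.
rewrite mulrCA divff ?lt0r_neq0// mulr1 => h1.
have h2 := sqr_sqrtB1_le a0.
have rE : r = p * (r / p) by field; exact: lt0r_neq0.
have h3 : (Num.sqrt (r / p) - 1) ^+ 2 = 0.
  apply/eqP; rewrite eq_le sqr_ge0 andbT; apply: (le_trans h2).
  by move: h1; rewrite [X in _ - X]rE; nra.
have /eqP : Num.sqrt (r / p) = 1.
  by apply/eqP; rewrite -subr_eq0 -sqrf_eq0 h3.
rewrite -sqrtr1 eqr_sqrt ?ler01 ?ltW// => /eqP e1.
by rewrite rE e1 mulr1.
Qed.

Section GoodOutcome.
Variables (R : realType) (m n : nat) (Xb : 'M[R]_(m, n)) (Y : 'M[nat]_(m, n)).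
Hypotheses (m_gt0 : (0 < m)%N) (n_gt0 : (0 < n)%N).
Hypothesis Xb_ge0 : forall i j, 0 <= Xb i j.
Hypothesis irrY : irreducible_draw Xb Y.
Let p : 'I_m -> R := row_sums R Y.
Let q : 'I_n -> R := col_sums R Y.
Implicit Types (u : 'I_m -> R) (v : 'I_n -> R).

(** The set where the properties hold is nonempty and closed under [Xb] arrows. If proper it is a
    closed cut, and some nonzero count leaves it, against the last premise. *)
Lemma irreducible_ind (P : 'I_m -> Prop) (Q : 'I_n -> Prop) :
  (exists i, P i) \/ (exists j, Q j) ->
  (forall i j, Xb i j != 0 -> Q j -> P i) ->
  (forall i j, Y i j != 0%N -> P i -> Q j) ->
  (forall i, P i) /\ (forall j, Q j).
Proof.
move=> PQ hX hY.
pose A := [set z : 'I_m + 'I_n |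
  match z with inl i => `[< P i >] | inr j => `[< Q j >] end]%SET.
have iA i : (inl i \in A) = `[< P i >] by rewrite inE.
have jA j : (inr j \in A) = `[< Q j >] by rewrite inE.
have A0 : #|A| != 0%N.
  rewrite cards_eq0; apply/set0Pn.
  by case: PQ => [[i Pi]|[j Qj]]; [exists (inl i)|exists (inr j)];
    rewrite ?iA ?jA; apply/asboolP.
have [AC|AC] := eqVneq #|~: A| 0%N.
  have all z : z \in A.
    by move/eqP: AC; rewrite cards_eq0 => /eqP /setP/(_ z); rewrite !inE => /negbFE.
  by split => [i|j]; [have := all (inl i); rewrite iA | have := all (inr j); rewrite jA];
    move/asboolP.
have cA : closed_cut Xb A.
  rewrite /closed_cut A0 AC /=; apply/forallP => i; apply/forallP => j.
  apply/implyP => /andP[]; rewrite iA jA => /asboolPn nP /asboolP Qj.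
  by apply/eqP/eqP; rewrite -[_ == _]negbK; apply/negP => /hX/(_ Qj)/nP.
have := irrY.2 A cA; rewrite negb_forall => /existsP[[i j]].
rewrite negb_imply /out_cut /= iA jA => /andP[/andP[/asboolP Pi /asboolPn nQ] /hY].
by move=> /(_ Pi)/nQ.
Qed.

Lemma supportY i j : Y i j != 0%N -> Xb i j != 0.
Proof. by apply: contraNneq => /irrY.1 ->. Qed.

(** Otherwise the single vertex [i] would be closed under both kinds of arrows. For columns, the set
    of all vertices but [j] plays this part. *)
Lemma row_sum_gt0 i : 0 < p i.
Proof.
rewrite ltr0n lt0n; apply/eqP => /eqP; rewrite sum_nat_eq0 => /forallP Yi.
have [] := @irreducible_ind (fun k => k = i) (fun=> False).
- by left; exists i.
- by [].
- by move=> k j /negP Yk ki; apply: Yk; rewrite ki; exact: Yi.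
- by move=> _ /(_ (Ordinal n_gt0)).
Qed.

Lemma col_sum_gt0 j : 0 < q j.
Proof.
rewrite ltr0n lt0n; apply/eqP => /eqP; rewrite sum_nat_eq0 => /forallP Yj.
have [] := @irreducible_ind (fun=> True) (fun k => k <> j).
- by left; exists (Ordinal m_gt0).
- by [].
- by move=> i k /negP Yk _ kj; apply: Yk; rewrite kj; exact: Yj.
- by move=> _ /(_ j).
Qed.

(** Each entry contributes a function of [u i - v j] alone, so shift invariance and edgewise bounds
    can be read off. *)
Lemma loglikE u v :
  loglik Xb p q u v =
  \sum_i \sum_j ((Y i j)%:R * (u i - v j) - Xb i j * expR (u i - v j)).
Proof.
rewrite /loglik.
under [X in _ = X]eq_bigr do rewrite sumrB.
rewrite [RHS]sumrB; congr (_ - _).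
under [X in _ = X]eq_bigr => i _.
  under eq_bigr do rewrite mulrBr.
  rewrite sumrB -mulr_suml -natr_sum; over.
rewrite [RHS]sumrB; congr (_ - _); rewrite exchange_big /=.
by apply: eq_bigr => j _; rewrite -mulr_suml -natr_sum.
Qed.

Lemma loglik_shift u v (c : R) :
  loglik Xb p q (fun i => u i + c) (fun j => v j + c) = loglik Xb p q u v.
Proof.
rewrite !loglikE; apply: eq_bigr => i _; apply: eq_bigr => j _.
by rewrite opprD addrACA subrr addr0.
Qed.

Lemma edge_level_bounded (L : R) i j : exists T : R, forall u v, L <= loglik Xb p q u v ->
  (Xb i j != 0 -> u i <= v j + T) /\ (Y i j != 0%N -> v j <= u i + T).
Proof.
have bnd k l : exists C, 0 <= C /\
    forall t, (Y k l)%:R * t - Xb k l * expR t <= C.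
  have [X0|Xn0] := eqVneq (Xb k l) 0.
    by exists 0; split => // t; rewrite X0 irrY.1// !mul0r subrr.
  have [|C C0 hC] := @mul_expR_bound R (Xb k l) (Y k l)%:R _ (ler0n _ _).
    by rewrite lt0r Xn0 Xb_ge0.
  by exists C.
have /choice[C hC] : forall k, exists Ck : 'I_n -> R, forall l, 0 <= Ck l /\
    forall t, (Y k l)%:R * t - Xb k l * expR t <= Ck l.
  by move=> k; have [Ck hCk] := choice (bnd k); exists Ck.
(* All terms but one are bounded above by the nonnegative [C], so on the superlevel set the term at
   (i, j) is at least L - S. *)
pose S := \sum_k \sum_l C k l.
have [T hT] := @level_bounded R (Xb i j) (Y i j)%:R (S - L) (Xb_ge0 i j) (ler0n _ _)
  (fun X0 => congr1 _ (irrY.1 i j X0)).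
exists T => u v; rewrite loglikE => Lle.
pose f k l := (Y k l)%:R * (u k - v l) - Xb k l * expR (u k - v l).
have fC k l : f k l <= C k l by exact: (hC k l).2.
have [] := hT (u i - v j).
  rewrite opprB lerBlDr (le_trans Lle)// -/(f i j).
  have SE : S - C i j = \sum_(l | l != j) C i l + \sum_(k | k != i) \sum_l C k l.
    by rewrite /S (bigD1 i)//= (bigD1 j)//=; ring.
  rewrite (bigD1 i)//= (bigD1 j)//= -/(f i j) -addrA lerD2l.
  apply: (@le_trans _ _ (S - C i j)); last by rewrite lerBlDr lerDl (hC i j).1.
  rewrite SE; apply: lerD; apply: ler_sum => k _; first exact: fC.
  by apply: ler_sum => l _; exact: fC.
move=> hX hY; split => [/hX|Yij]; first lra.
by have := hY; rewrite pnatr_eq0 => /(_ Yij); lra.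
Qed.

(** The anchor [w] may be any coordinate: anchoring at [i0] gives upper bounds, and anchoring
    elsewhere and reading off at [i0] gives the lower ones. *)
Lemma level_upper_bounded (L : R) (w : ('I_m -> R) -> ('I_n -> R) -> R) :
  (exists i, w = fun u _ => u i) \/ (exists j, w = fun _ v => v j) ->
  (forall i, exists K : R, forall u v, L <= loglik Xb p q u v -> u i <= w u v + K) /\
  (forall j, exists K : R, forall u v, L <= loglik Xb p q u v -> v j <= w u v + K).
Proof.
move=> hw; apply: irreducible_ind.
- by case: hw => [[i ->]|[j ->]]; [left; exists i|right; exists j];
    exists 0 => u v _; rewrite addr0.
- move=> i j Xij [K hK]; have [T hT] := edge_level_bounded L i j.
  exists (K + T) => u v Lle; have [/(_ Xij) h _] := hT u v Lle.
  by have := hK u v Lle; lra.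
- move=> i j Yij [K hK]; have [T hT] := edge_level_bounded L i j.
  exists (K + T) => u v Lle; have [_ /(_ Yij) h] := hT u v Lle.
  by have := hK u v Lle; lra.
Qed.

Let i0 : 'I_m := Ordinal m_gt0.

Lemma level_norm_bounded (L : R) :
  (forall i, exists K : R, forall u v, L <= loglik Xb p q u v -> `|u i - u i0| <= K) /\
  (forall j, exists K : R, forall u v, L <= loglik Xb p q u v -> `|v j - u i0| <= K).
Proof.
have [h1 h2] := @level_upper_bounded L (fun u _ => u i0) (or_introl (ex_intro _ i0 erefl)).
split => [i|j].
  have [K1 hK1] := h1 i.
  have [/(_ i0) [K2 hK2] _] :=
    @level_upper_bounded L (fun u _ => u i) (or_introl (ex_intro _ i erefl)).
  exists (`|K1| + `|K2|) => u v Lle; have := hK1 u v Lle; have := hK2 u v Lle.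
  have := ler_norm K1; have := ler_norm K2; have := normr_ge0 K1; have := normr_ge0 K2.
  by rewrite ler_norml => *; apply/andP; split; lra.
have [K1 hK1] := h2 j.
have [/(_ i0) [K2 hK2] _] :=
  @level_upper_bounded L (fun _ v => v j) (or_intror (ex_intro _ j erefl)).
exists (`|K1| + `|K2|) => u v Lle; have := hK1 u v Lle; have := hK2 u v Lle.
have := ler_norm K1; have := ler_norm K2; have := normr_ge0 K1; have := normr_ge0 K2.
by rewrite ler_norml => *; apply/andP; split; lra.
Qed.

Lemma cvg_loglik (T : Type) (F : set_system T) (FF : Filter F)
    (U : T -> 'I_m -> R) (V : T -> 'I_n -> R) u v :
  (forall i, U x i @[x --> F] --> u i) -> (forall j, V x j @[x --> F] --> v j) ->
  loglik Xb p q (U x) (V x) @[x --> F] --> loglik Xb p q u v.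
Proof.
move=> cU cV; apply: cvgB; first apply: cvgB.
- apply: cvg_big => [|i _]; first exact: add_continuous.
  by apply: cvgM; [exact: cvg_cst | exact: cU].
- apply: cvg_big => [|j _]; first exact: add_continuous.
  by apply: cvgM; [exact: cvg_cst | exact: cV].
- apply: cvg_big => [|i _]; first exact: add_continuous.
  apply: cvg_big => [|j _]; first exact: add_continuous.
  apply: cvgM; first exact: cvg_cst.
  apply: (cvg_comp (fun x => U x i - V x j) expR); last exact: continuous_expR.
  by apply: cvgB; [exact: cU | exact: cV].
Qed.

Lemma maximizer_exists : exists u v, is_maximizer Xb p q u v.
Proof.
pose L := loglik Xb p q (fun=> 0) (fun=> 0).
have [/choice[K1 hK1] /choice[K2 hK2]] := level_norm_bounded L.
pose U (x : 'rV[R]_(m + n)) i := x ord0 (lshift n i).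
pose V (x : 'rV[R]_(m + n)) j := x ord0 (rshift m j).
pose K (k : 'I_(m + n)) :=
  match fintype.split k return R with inl i => K1 i | inr j => K2 j end.
pose box : set 'rV[R]_(m + n) := [set x | forall k, `[- K k, K k]%classic (x ord0 k)].
have cbox : compact box.
  apply: (@rV_compact R (m + n) (fun k => `[- K k, K k]%classic)) => k.
  exact: segment_compact.
have K_ge0 k : 0 <= K k.
  rewrite /K; case: fintype.split => [i|j].
    by have := hK1 i (fun=> 0) (fun=> 0) (lexx _); rewrite subrr normr0.
  by have := hK2 j (fun=> 0) (fun=> 0) (lexx _); rewrite subrr normr0.
have box0 : box !=set0.
  by exists 0 => k /=; rewrite in_itv/= mxE oppr_le0 K_ge0.
pose f x := loglik Xb p q (U x) (V x).
have cf : continuous f.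
  by move=> x; apply: (cvg_loglik (nbhs_filter x)) => k; exact: coord_continuous.
have [c _ hc] := compact_EVT_max box0 cbox (continuous_subspaceT cf).
exists (U c), (V c) => u v; rewrite -/(f c).
(* Points normalized at [i0] in the superlevel set lie in the box. Other points of the superlevel
   set are shifted there, and points below [L] are beaten by the origin. *)
have inbox u' v' : L <= loglik Xb p q u' v' -> u' i0 = 0 ->
    loglik Xb p q u' v' <= f c.
  move=> Lle u0; pose x := row_mx (\row_i u' i) (\row_j v' j) : 'rV[R]_(m + n).
  have -> : loglik Xb p q u' v' = f x.
    by rewrite /f; congr loglik; apply/funext => k; rewrite /U /V ?row_mxEl ?row_mxEr mxE.
  apply: hc; rewrite inE => k /=; rewrite in_itv/= -ler_norml /x /K mxE.
  case: fintype.split => [i|j]; rewrite mxE.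
    by have := hK1 i u' v' Lle; rewrite u0 subr0.
  by have := hK2 j u' v' Lle; rewrite u0 subr0.
have [Lle|/ltW Lgt] := leP L (loglik Xb p q u v).
  rewrite -(loglik_shift u v (- u i0)); apply: inbox; last exact: subrr.
  by rewrite loglik_shift.
by apply: (le_trans Lgt); apply: inbox.
Qed.

(** * Margins, uniqueness and attraction of IPF at a maximizer *)

Section Maximizer.
Variables (u : 'I_m -> R) (v : 'I_n -> R).
Let Z i j := Xb i j * expR (u i - v j).

Lemma scaled_ge0 i j : 0 <= Z i j.
Proof. by rewrite mulr_ge0 ?expR_ge0. Qed.

Lemma scaled_gt0 i j : Xb i j != 0 -> 0 < Z i j.
Proof. by move=> X0; rewrite mulr_gt0 ?expR_gt0// lt0r X0 Xb_ge0. Qed.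

Lemma loglik_diff (a : 'I_m -> R) (b : 'I_n -> R) :
  loglik Xb p q (fun i => u i + a i) (fun j => v j + b j) - loglik Xb p q u v =
  \sum_i p i * a i - \sum_j q j * b j
  - \sum_i \sum_j Z i j * (expR (a i - b j) - 1).
Proof.
rewrite /loglik.
have -> : \sum_i \sum_j Z i j * (expR (a i - b j) - 1) =
    \sum_i \sum_j Xb i j * expR (u i + a i - (v j + b j)) -
    \sum_i \sum_j Xb i j * expR (u i - v j).
  rewrite -sumrB; apply: eq_bigr => i _; rewrite -sumrB; apply: eq_bigr => j _.
  by rewrite /Z opprD addrACA (expRD (u i - v j)); ring.
under eq_bigr do rewrite mulrDr.
under [X in _ - X - _ - _]eq_bigr do rewrite mulrDr.
by rewrite !big_split /=; ring.
Qed.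

Lemma maximizer_margins : is_maximizer Xb p q u v ->
  (forall i, \sum_j Z i j = p i) /\ (forall j, \sum_i Z i j = q j).
Proof.
move=> maxuv; split => [i|j]; apply: stationary_scalar.
- exact: row_sum_gt0.
- by apply: sumr_ge0 => j _; exact: scaled_ge0.
- move=> t; have := maxuv (fun k => u k + (k == i)%:R * t) (fun l => v l + 0).
  rewrite -subr_le0 loglik_diff.
  rewrite (bigD1 i)//= eqxx mul1r big1 ?addr0; last first.
    by move=> k /negbTE ->; rewrite mul0r mulr0.
  rewrite [X in _ - X - _]big1; last by move=> l _; rewrite mulr0.
  rewrite subr0 (bigD1 i)//= [X in _ - (_ + X)]big1; last first.
    move=> k /negbTE ->; apply: big1 => l _.
    by rewrite mul0r subr0 expR0 subrr mulr0.
  rewrite addr0 subr_le0 => /le_trans; apply.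
  by rewrite mulr_suml; apply: ler_sum => l _; rewrite eqxx mul1r subr0.
- exact: col_sum_gt0.
- by apply: sumr_ge0 => i _; exact: scaled_ge0.
(* The perturbation is negative because [v] enters with the opposite sign. *)
- move=> t; have := maxuv (fun k => u k + 0) (fun l => v l + - ((l == j)%:R * t)).
  rewrite -subr_le0 loglik_diff.
  rewrite [X in X - _ - _]big1; last by move=> l _; rewrite mulr0.
  rewrite sub0r (bigD1 j)//= eqxx mul1r big1 ?addr0; last first.
    by move=> k /negbTE ->; rewrite mul0r oppr0 mulr0.
  rewrite mulrN opprK exchange_big (bigD1 j)//= [X in _ - (_ + X)]big1; last first.
    move=> k /negbTE ->; apply: big1 => l _.
    by rewrite mul0r oppr0 subr0 expR0 subrr mulr0.
  rewrite addr0 subr_le0 => /le_trans; apply.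
  by rewrite mulr_suml; apply: ler_sum => l _; rewrite eqxx mul1r opprK add0r.
Qed.

(** With the margins matched, the gap between two maximal values is a sum of terms [Z] (expR d - 1 -
    d), d = a_i - b_j. It is zero, so the two displacements agree along every edge. *)
Lemma maximizer_unique : is_maximizer Xb p q u v ->
  unique_maximizer_up_to_shift Xb p q u v.
Proof.
move=> maxuv; split => // u' v' maxuv'.
have [rowZ colZ] := maximizer_margins maxuv.
pose a i := u' i - u i; pose b j := v' j - v j.
have u'E : u' = fun i => u i + a i by apply/funext => i; rewrite /a addrC subrK.
have v'E : v' = fun j => v j + b j by apply/funext => j; rewrite /b addrC subrK.
have t0 i j : 0 <= Z i j * (expR (a i - b j) - 1 - (a i - b j)).
  by rewrite mulr_ge0 ?scaled_ge0//; have := expR_ge1Dx (a i - b j); lra.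
have sum0 : \sum_i \sum_j Z i j * (expR (a i - b j) - 1 - (a i - b j)) = 0.
  have -> : \sum_i \sum_j Z i j * (expR (a i - b j) - 1 - (a i - b j)) =
      loglik Xb p q u v - loglik Xb p q u' v'.
    rewrite -opprB u'E v'E loglik_diff.
    have -> : \sum_i p i * a i = \sum_i \sum_j Z i j * a i.
      by apply: eq_bigr => i _; rewrite -rowZ mulr_suml.
    have -> : \sum_j q j * b j = \sum_i \sum_j Z i j * b j.
      by rewrite exchange_big; apply: eq_bigr => j _; rewrite -colZ mulr_suml.
    rewrite !opprB -sumrB -big_split /=; apply: eq_bigr => i _.
    by rewrite -sumrB -big_split /=; apply: eq_bigr => j _; ring.
  by apply/eqP; rewrite subr_eq0 eq_le maxuv maxuv'.
have ab i j : Xb i j != 0 -> a i = b j.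
  move=> Xij; apply/eqP; rewrite -subr_eq0; apply/negPn/negP => d0.
  have : 0 < \sum_i \sum_j Z i j * (expR (a i - b j) - 1 - (a i - b j)).
    rewrite (bigD1 i)//= (bigD1 j)//= -addrA ltr_wpDr//.
      by rewrite addr_ge0// sumr_ge0// => k _; rewrite sumr_ge0.
    by rewrite mulr_gt0 ?scaled_gt0//; have := expR_gt1Dx d0; lra.
  by rewrite sum0 ltxx.
exists (a i0).
have [ha hb] : (forall i, a i = a i0) /\ (forall j, b j = a i0).
  apply: irreducible_ind.
  - by left; exists i0.
  - by move=> i j /ab ->.
  - by move=> i j /supportY/ab ->.
by split => [i|j]; rewrite ?u'E ?v'E ?ha ?hb.
Qed.

Lemma ipf_converges : is_maximizer Xb p q u v ->
  exists c : R, ipf_converges_to Xb p q (fun i => u i + c) (fun j => v j + c).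
Proof.
move=> maxuv; have [rowZ colZ] := maximizer_margins maxuv.
pose d k := ipf Xb p q k.
(* Ratios of the IPF factors to the exact scaling given by the maximizer. *)
pose r k i := (d k).1 i * expR (- u i); pose s k j := (d k).2 j * expR (v j).
have rE k i : r k.+1 i = p i / \sum_j Z i j * s k j.
  rewrite /r /d /ipf iterS /= -/(ipf _ _ _ k) -/(d k).
  rewrite -mulrA; congr (_ * _); rewrite expRN -invfM; congr (_^-1).
  rewrite mulr_suml; apply: eq_bigr => j _; rewrite /Z /s expRD.
  have : expR (- v j) * expR (v j) = 1 by rewrite mulrC expRxMexpNx_1.
  by move=> e; rewrite -[in LHS](mulr1 (_ * _ * _)) -e; ring.
have sE k j : s k.+1 j = q j / \sum_i Z i j * r k.+1 i.
  rewrite /s /d /ipf iterS /=.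
  rewrite -mulrA; congr (_ * _); rewrite -[expR (v j)]invrK -expRN -invfM; congr (_^-1).
  rewrite mulr_suml; apply: eq_bigr => i _; rewrite /Z /r /d /ipf iterS /= expRD.
  have : expR (u i) * expR (- u i) = 1 by exact: expRxMexpNx_1.
  by move=> e; rewrite -[in LHS](mulr1 (_ * _ * _)) -e; ring.
have s0 j : s 0 j = expR (v j) by rewrite /s /d /ipf /= mul1r.
(* Sums serve as crude bounds for the largest and smallest initial [s]. *)
pose B := \sum_j expR (v j); pose A := (\sum_j expR (- v j))^-1.
have le_sum (g : 'I_n -> R) j : (forall l, 0 < g l) -> g j <= \sum_l g l.
  by move=> g0; rewrite (bigD1 j)//= lerDl sumr_ge0// => l _; exact: ltW.
have sum_gt0 (g : 'I_n -> R) : (forall l, 0 < g l) -> 0 < \sum_l g l.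
  by move=> g0; apply: lt_le_trans (g0 (Ordinal n_gt0)) (le_sum g _ g0).
have B0 : 0 < B by apply: sum_gt0 => l; exact: expR_gt0.
have AV0 : 0 < \sum_j expR (- v j) by apply: sum_gt0 => l; exact: expR_gt0.
have A0 : 0 < A by rewrite invr_gt0.
have sAB j : A <= s 0 j <= B.
  rewrite s0; apply/andP; split; last by apply: le_sum => l; exact: expR_gt0.
  rewrite -[expR (v j)]invrK -expRN lef_pV2 ?posrE ?expR_gt0//.
  by apply: le_sum => l; exact: expR_gt0.
have [hr1 hs1] : (forall i, B^-1 <= r 1 i <= A^-1) /\ (forall j, A <= s 1 j <= B).
  have hr i : B^-1 <= r 1 i <= A^-1.
    rewrite rE -rowZ; apply: harmonic_mean_bounds => //; first exact: scaled_ge0.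
    by rewrite rowZ; exact: row_sum_gt0.
  split => // j.
  have := @harmonic_mean_bounds R _ (fun i => Z i j) (r 1) B^-1 A^-1.
  rewrite (invrK A) (invrK B) sE -colZ; apply; rewrite ?invr_gt0 ?colZ//.
    by move=> i; exact: scaled_ge0.
  exact: col_sum_gt0.
have conn (P : 'I_m -> Prop) (Q : 'I_n -> Prop) (j0 : 'I_n) :
    Q j0 -> (forall i j, 0 < Z i j -> (P i <-> Q j)) ->
    (forall i, P i) /\ (forall j, Q j).
  move=> Qj0 PQ; apply: irreducible_ind; first by right; exists j0.
    by move=> i j /scaled_gt0 /PQ iff_ij; apply iff_ij.
  by move=> i j /supportY/scaled_gt0 /PQ iff_ij; apply iff_ij.
(* The convergence result is applied from index 1, because the all-ones start need not satisfy the
   column update equation. *)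
have [c c0 [rc sc]] := sinkhorn_cvg n_gt0 scaled_ge0 rowZ colZ row_sum_gt0 col_sum_gt0 conn
  A0 B0 hs1 (fun k => sE k) (fun k => rE k.+1) hr1.
(* The limits 1/c of [r] and [c] of [s] amount to shifting both parameters by - ln c. *)
exists (- ln c); split => [i|j].
  rewrite -cvg_shiftS /=.
  have -> : (fun k => (ipf Xb p q k.+1).1 i) = (fun k => r k.+1 i * expR (u i)).
    by apply/funext => k; rewrite /r -mulrA [expR (- _) * _]mulrC expRxMexpNx_1 mulr1.
  rewrite addrC expRD expRN lnK ?posrE//.
  apply: cvgM; [exact: rc | exact: cvg_cst].
rewrite -cvg_shiftS /=.
have -> : (fun k => (ipf Xb p q k.+1).2 j) = (fun k => s k.+1 j * expR (- v j)).
  by apply/funext => k; rewrite /s -mulrA expRxMexpNx_1 mulr1.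
rewrite opprD opprK addrC expRD lnK ?posrE//.
apply: cvgM; [exact: sc | exact: cvg_cst].
Qed.

End Maximizer.

Lemma irreducible_good_outcome : good_outcome Xb Y.
Proof.
have [u [v maxuv]] := maximizer_exists.
have [c ipfc] := ipf_converges maxuv.
exists (fun i => u i + c), (fun j => v j + c); split => //.
by apply: maximizer_unique => u' v'; rewrite loglik_shift.
Qed.

End GoodOutcome.

Unset Implicit Arguments.

Theorem mainTheorem5 (R : realType) (m n : nat) (Xb : 'M[R]_(m, n))
    (us : 'I_m -> R) (vs : 'I_n -> R) :
  (0 < m)%N -> (0 < n)%N ->
  (forall i j, 0 <= Xb i j) ->
  (exists s : seq R,
      sorted_spectrum (bp_laplacian (bp_weight Xb us vs)) s /\
      8 * ln (m + n)%:R <= s`_1) ->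
  ((1 - 2 / Num.sqrt (m + n)%:R)%:E
     <= bp_prob Xb us vs [set Y | good_outcome Xb Y])%E.
Proof.
move=> m0 n0 X0 [s [spec gap]].
apply: bp_prob_ge_union_bound => //; last exact: cut_union_bound spec gap.
by move=> Y irrY; exact: irreducible_good_outcome.
Qed.
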